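(* Let $\mathbf{p}_1,\dots,\mathbf{p}_n$ be independent uniform points in $[0,1]^d$ and let $M_{d,d-1}(n)$ be the number of $(d-1)$-dominant skyline points of this sample. Let $d=d(n)\ge3$ be integers such that \[ \frac{2\log n}{d^2}-W(2\log n)\to\infty\qquad(n\to\infty). \] Then \[ \mathbb{E}[M_{d,d-1}(n)]=\frac{n^{-\frac1{d-1}}}{d-1}\,\Gamma\!\left(\frac1{d-1}\right)^{d}\left(1+O\!\left(d\,n^{-\frac1{(d-1)(d-2)}}\right)\right) \] as $n\to\infty$, uniformly in $d$ (the implied constant does not depend on $d$).
   Context: $\mathbf{p}$ $(d-1)$-dominates $\mathbf{q}$ in $\mathbb{R}^d$ if there is a set $S$ of $d-1$ coordinates with $p_j\le q_j$ for all $j\in S$ and $p_j<q_j$ for some $j\in S$; a sample point is a $(d-1)$-dominant skyline point if no other sample point $(d-1)$-dominates it. $W$ denotes the principal branch of the Lambert $W$-function, defined by $W(z)e^{W(z)}=z$ and positive for $z>0$. $\Gamma$ is Euler's Gamma function. *)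

(* Defs.v *)
From HB Require Import structures.
From mathcomp Require Import all_boot all_order all_algebra.
From mathcomp Require Import all_classical all_reals all_analysis.

Set Implicit Arguments.
Unset Strict Implicit.
Unset Printing Implicit Defensive.

Import Order.TTheory GRing.Theory Num.Theory.
Import numFieldNormedType.Exports.

Local Open Scope classical_set_scope.
Local Open Scope ring_scope.

Section special_functions.
Context {R : realType}.

Definition Gamma (s : R) : R :=
  \int[lebesgue_measure]_(t in `]0, +oo[) (t `^ (s - 1) * expR (- t)).

(* Real principal branch: on [-1, +oo[ the map w |-> w * expR w is injective
   with image [- expR (-1), +oo[; outside that image the value is 0. *)
Definition lambertW (z : R) : R :=
  xget 0 [set w | -1 <= w /\ w * expR w = z].

Lemma lambertWP (z : R) :
  0 < z -> 0 < lambertW z /\ lambertW z * expR (lambertW z) = z.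
Proof.
move=> z0; have z0' := ltW z0.
have cf : {within `[0, z], continuous (fun w : R => w * expR w)}.
  apply: continuous_subspaceT => x.
  by apply: cvgM; [exact: cvg_id | exact: continuous_expR].
have [] := @IVT R (fun w => w * expR w) 0 z z z0' cf.
  rewrite mul0r; have le1 : z <= z * expR z.
    by rewrite ler_peMr// -expR0 ler_expR.
  by rewrite (min_idPl _) ?(le_trans z0')// (max_idPr _) ?(le_trans z0') ?z0'.
move=> c; rewrite in_itv/= => /andP[c0 _] cE.
rewrite /lambertW; case: xgetP => [w _ [_ wE]|/(_ c)[]]; last first.
  by split=> //; rewrite (le_trans _ c0)// lerN10.
by split=> //; move: z0; rewrite -wE pmulr_lgt0// expR_gt0.
Qed.

Lemma lambertW_unique (z w : R) :
  0 < z -> 0 < w -> w * expR w = z -> w = lambertW z.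
Proof.
move=> z0; have [+ +] := lambertWP z0; move: (lambertW z) => v v0 vE w0 wE.
apply/eqP; rewrite eq_le !leNgt; apply/andP; split; apply/negP => h.
- suff : v * expR v < w * expR w by rewrite vE wE ltxx.
  by rewrite ltr_pM ?expR_ge0 ?ltr_expR ?ltW.
- suff : w * expR w < v * expR v by rewrite vE wE ltxx.
  by rewrite ltr_pM ?expR_ge0 ?ltr_expR ?ltW.
Qed.

End special_functions.

Section skyline.
Context {R : realType} (d : nat).

Definition kdominates (k : nat) (p q : d.-tuple R) : bool :=
  [exists S : {set 'I_d}, [&& #|S| == k,
    [forall j in S, tnth p j <= tnth q j] &
    [exists j in S, tnth p j < tnth q j]]].

Definition kskyline (n k : nat) (p : 'I_n -> d.-tuple R) : {set 'I_n} :=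
  [set i | [forall i', (i' != i) ==> ~~ kdominates k (p i') (p i)]]%SET.

End skyline.

Section random_sample.
Context {R : realType} {disp : measure_display} {T : measurableType disp}.
Variable P : probability T R.
Local Open Scope ereal_scope.

(* The law of X is the product of d copies of Lebesgue measure on [0, 1],
   i.e. d-dimensional Lebesgue measure restricted to the unit cube. *)
Definition uniform_cube (d : nat) (X : {RV P >-> d.-tuple R}) : Prop :=
  forall A : 'I_d -> set R, (forall j, measurable (A j)) ->
    distribution P X [set x | forall j, A j (tnth x j)] =
    \prod_(j < d) lebesgue_measure (A j `&` `[0%R, 1%R]).

Definition mutually_independent (n : nat) (disp' : measure_display)
    (T' : measurableType disp') (X : 'I_n -> {RV P >-> T'}) : Prop :=
  forall (J : {set 'I_n}) (B : 'I_n -> set T'), (forall i, measurable (B i)) ->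
    P (\bigcap_(i in [set` J]) (X i @^-1` B i)) =
    \prod_(i in J) P (X i @^-1` B i).

Definition skyline_count (n d k : nat) (X : 'I_n -> {RV P >-> d.-tuple R})
    (w : T) : R :=
  (#|kskyline k (fun i => X i w)|%:R)%R.

End random_sample.

(* Main.v *)
Require Import Defs.
From HB Require Import structures.
From mathcomp Require Import all_boot all_order all_algebra.
From mathcomp Require Import all_classical all_reals all_analysis.
From mathcomp Require Import measurable_realfun.
From mathcomp Require Import ring lra.
Import Order.TTheory GRing.Theory Num.Theory.
Import numFieldNormedType.Exports.
Local Open Scope classical_set_scope.
Local Open Scope ring_scope.

Set Implicit Arguments.
Unset Strict Implicit.
Unset Printing Implicit Defensive.

(** Conditioning on one sample point [x] gives [E = n * \int (1 - beta x)^(n-1) dx] over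
    the unit cube, where [beta x], the probability that a uniform point (d-1)-dominates
    [x], satisfies [S - (d-1) P <= beta x <= S] with [P = \prod_j x_j] and
    [S = \sum_i \prod_(j != i) x_j].  Put [s = 1/(d-1)] and pass to the coordinates
    [v_i = ln (n * \prod_(j != i) x_j)], an affine image of [ln x] of determinant [d-1] up
    to sign: [n dx] becomes [s * n^(-s) * exp (s * \sum_i v_i) dv] and [n S] becomes
    [\sum_i exp v_i].  Hence replacing [(1 - beta x)^(n-1)] by [exp (- n S)] and dropping
    the constraint [x <= 1] yields exactly [s * n^(-s) * Gamma(s)^d].  Dropping
    [x_i <= 1] costs a relative error [O(n^(-1/((d-1)(d-2))))] for each [i]; the
    exponential approximation costs [O(n^(-1/2))] from below and [O(d * n^(-s))] from
    above, the latter because [n P = n^(-s) * exp (s * \sum_i v_i)]. *)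

(** * Iterated integrals over tuples *)

Section iterated_integral.
Context {R : realType} {disp : measure_display} {T : measurableType disp}.
Variable mu : {sigma_finite_measure set T -> \bar R}.
Local Open Scope ereal_scope.

(** Uniformity in [d] governs the estimates. With [k = d - 1] and [s = 1/k], the main term is
    [Gamma(s)^(k+1)], and [Gamma(s) >= k / (1 + s)] makes [k^(k+1)] at most [e^2] times as large.
    Errors are therefore tracked to the order [k^(k+1)], where losing one further factor [k] already
    matters. The exponent [1/((d-1)(d-2))] comes from the constraint [x_i <= 1]. Its complement is
    [v_i < s' * (\sum_(j != i) v_j - ln n)] with [s' = 1/(d-2)]. Integrating [exp (s * v_i)] over
    this half-line gives [n^(-s s') / s] and turns the exponent [s] of the other [k] coordinates
    into [s + s s' = s']. What remains is [Gamma(s')^k], at most [e^4] times [Gamma(s)^k], while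
    [1/s = k <= 2 Gamma(s)]. Multiple integrals are nested one-variable integrals over tuples, so
    the change to the coordinates [v] needs only Tonelli and one-dimensional substitutions:
    [x = exp u], dilations, shifts and reflections. *)

Fixpoint iterint (k : nat) : (k.-tuple T -> \bar R) -> \bar R :=
  if k is k'.+1 then
    fun F => \int[mu]_x iterint (fun t => F (cons_tuple x t))
  else fun F => F [tuple].

Lemma iterint_ge0 k (F : k.-tuple T -> \bar R) :
  (forall t, 0 <= F t) -> 0 <= iterint F.
Proof.
elim: k F => [|k ih] F F0 //=; apply: integral_ge0 => x _; exact: ih.
Qed.

Lemma measurable_fun_cons_tuple disp' (S : measurableType disp') k
    (f : S -> T) (g : S -> k.-tuple T) :
  measurable_fun setT f -> measurable_fun setT g ->
  measurable_fun setT (fun s => cons_tuple (f s) (g s)).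
Proof. by move=> mf mg; apply: measurable_cons. Qed.

(** The parameter space [S] is arbitrary because the induction moves the head coordinate of the
    tuple into it. *)
Lemma measurable_iterint disp' (S : measurableType disp') k
    (F : S -> k.-tuple T -> \bar R) :
  measurable_fun setT (fun p : S * k.-tuple T => F p.1 p.2) ->
  (forall s t, 0 <= F s t) -> measurable_fun setT (fun s => iterint (F s)).
Proof.
elim: k disp' S F => [|k ih] disp' S F mF F0 /=.
  by apply: (measurableT_comp mF (g := fun s => (s, [tuple]))).
apply: (measurable_fun_fubini_tonelli_F
  (fun p : S * T => iterint (fun t => F p.1 (cons_tuple p.2 t)))) => /=.
- apply: (ih _ _ (fun p t => F p.1 (cons_tuple p.2 t))) => //.
  apply: (measurableT_comp mF
    (g := fun q : (S * T) * k.-tuple T => (q.1.1, cons_tuple q.1.2 q.2))).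
  apply/measurable_fun_pair; first exact: measurableT_comp.
  by apply: measurable_fun_cons_tuple => //; exact: measurableT_comp.
- by move=> p; apply: iterint_ge0.
Qed.

Lemma measurable_fun_section disp1 disp2 disp3 (T1 : measurableType disp1)
    (T2 : measurableType disp2) (T3 : measurableType disp3) (f : T1 * T2 -> T3) x :
  measurable_fun setT f -> measurable_fun setT (fun y => f (x, y)).
Proof. by move=> mf; apply: measurableT_comp. Qed.

Lemma measurable_consl k (F : k.+1.-tuple T -> \bar R) :
  measurable_fun setT F ->
  measurable_fun setT (fun p : T * k.-tuple T => F (cons_tuple p.1 p.2)).
Proof.
move=> mF; apply: (measurableT_comp mF
    (g := fun p : T * k.-tuple T => cons_tuple p.1 p.2)).
exact: measurable_fun_cons_tuple.
Qed.

Lemma measurable_consx k (F : k.+1.-tuple T -> \bar R) x :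
  measurable_fun setT F ->
  measurable_fun setT (fun t => F (cons_tuple x t)).
Proof. by move=> /measurable_consl /(measurable_fun_section x). Qed.

Lemma measurable_iterint_cons k (F : k.+1.-tuple T -> \bar R) :
  measurable_fun setT F -> (forall t, 0 <= F t) ->
  measurable_fun setT (fun x => iterint (fun t => F (cons_tuple x t))).
Proof.
by move=> mF F0; apply: measurable_iterint => //; exact: measurable_consl.
Qed.

Lemma le_iterint k (F G : k.-tuple T -> \bar R) :
  measurable_fun setT F -> measurable_fun setT G ->
  (forall t, 0 <= F t) -> (forall t, F t <= G t) -> iterint F <= iterint G.
Proof.
elim: k F G => [|k ih] F G mF mG F0 FG //=.
have G0 t : 0 <= G t by apply: le_trans (FG t).
apply: ge0_le_integral => //.
- by move=> x _; apply: iterint_ge0.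
- exact: measurable_iterint_cons.
- exact: measurable_iterint_cons.
- by move=> x _; apply: ih => //; exact: measurable_consx.
Qed.

Lemma iterintZl k (F : k.-tuple T -> \bar R) (c : R) :
  measurable_fun setT F -> (forall t, 0 <= F t) -> (0 <= c)%R ->
  iterint (fun t => c%:E * F t) = c%:E * iterint F.
Proof.
elim: k F => [|k ih] F mF F0 c0 //=.
rewrite -ge0_integralZl_EFin//.
- by apply: eq_integral => x _; rewrite ih//; exact: measurable_consx.
- by move=> x _; apply: iterint_ge0.
- exact: measurable_iterint_cons.
Qed.

Lemma iterintD k (F G : k.-tuple T -> \bar R) :
  measurable_fun setT F -> measurable_fun setT G ->
  (forall t, 0 <= F t) -> (forall t, 0 <= G t) ->
  iterint (fun t => F t + G t) = iterint F + iterint G.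
Proof.
elim: k F G => [|k ih] F G mF mG F0 G0 //=.
rewrite -ge0_integralD//.
- by apply: eq_integral => x _; rewrite ih//; exact: measurable_consx.
- by move=> x _; apply: iterint_ge0.
- exact: measurable_iterint_cons.
- by move=> x _; apply: iterint_ge0.
- exact: measurable_iterint_cons.
Qed.

Lemma iterint0 k : iterint (fun _ : k.-tuple T => 0) = 0.
Proof.
by elim: k => //= k ih; under eq_integral do rewrite ih; rewrite integral0.
Qed.

Lemma iterint_sum (I : Type) (s : seq I) k (F : I -> k.-tuple T -> \bar R) :
  (forall i, measurable_fun setT (F i)) -> (forall i t, 0 <= F i t) ->
  iterint (fun t => \sum_(i <- s) F i t) = \sum_(i <- s) iterint (F i).
Proof.
move=> mF F0; elim: s => [|i s ih].
  rewrite big_nil -[RHS](iterint0 k); congr iterint.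
  by apply/funext => t; rewrite big_nil.
rewrite big_cons -ih -iterintD//.
- by congr iterint; apply/funext => t; rewrite big_cons.
- exact: emeasurable_sum.
- by move=> t; apply: sume_ge0.
Qed.

Lemma iterint_integral disp' (S : measurableType disp')
    (nu : {sigma_finite_measure set S -> \bar R}) k (F : S -> k.-tuple T -> \bar R) :
  measurable_fun setT (fun p : S * k.-tuple T => F p.1 p.2) ->
  (forall s t, 0 <= F s t) ->
  \int[nu]_s iterint (F s) = iterint (fun t => \int[nu]_s F s t).
Proof.
elim: k F => [|k ih] F mF F0 //=.
rewrite (fubini_tonelli (fun p : S * T => iterint (fun t => F p.1 (cons_tuple p.2 t)))) /=.
- apply: eq_integral => x _; rewrite ih//.
  apply: (measurableT_comp mF (g := fun q : S * k.-tuple T => (q.1, cons_tuple x q.2))).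
  by apply/measurable_fun_pair => //; exact: measurable_fun_cons_tuple.
- apply: measurable_iterint => //.
  apply: (measurableT_comp mF
    (g := fun q : (S * T) * k.-tuple T => (q.1.1, cons_tuple q.1.2 q.2))).
  apply/measurable_fun_pair; first exact: measurableT_comp.
  by apply: measurable_fun_cons_tuple => //; exact: measurableT_comp.
- by move=> p; apply: iterint_ge0.
Qed.

Lemma iterint_prod k (f : 'I_k -> T -> R) :
  (forall i, measurable_fun setT (f i)) -> (forall i x, 0 <= f i x)%R ->
  iterint (fun t => (\prod_(i < k) f i (tnth t i))%:E) =
  \prod_(i < k) \int[mu]_x (f i x)%:E.
Proof.
elim: k f => [|k ih] f mf f0 /=; first by rewrite !big_ord0.
have mp : measurable_fun setT
    (fun t : k.-tuple T => (\prod_(i < k) f (lift ord0 i) (tnth t i))%:E).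
  apply/measurable_EFinP; apply: measurable_prod => i _.
  exact: (measurableT_comp (mf _) (measurable_tnth _)).
have p0 (t : k.-tuple T) : 0 <= (\prod_(i < k) f (lift ord0 i) (tnth t i))%:E.
  by rewrite lee_fin; apply: prodr_ge0.
rewrite big_ord_recl -(ih (fun i => f (lift ord0 i)))//.
rewrite -ge0_integralZr//; last 3 first.
- exact/measurable_EFinP.
- by move=> x _; rewrite lee_fin.
- exact: iterint_ge0.
apply: eq_integral => x _; rewrite -iterintZl//.
congr iterint; apply/funext => t; rewrite big_ord_recl tnth0 EFinM.
by under eq_bigr do rewrite tnthS.
Qed.

Definition insert_tuple k (i : 'I_k.+1) (x : T) (t : k.-tuple T) : k.+1.-tuple T :=
  [tuple oapp (tnth t) x (unlift i j) | j < k.+1].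

Lemma tnth_insert_id k (i : 'I_k.+1) x t : tnth (insert_tuple i x t) i = x.
Proof. by rewrite tnth_mktuple unlift_none. Qed.

Lemma tnth_insert_lift k (i : 'I_k.+1) x t j :
  tnth (insert_tuple i x t) (lift i j) = tnth t j.
Proof. by rewrite tnth_mktuple liftK. Qed.

Lemma insert_tuple0 k x (t : k.-tuple T) : insert_tuple ord0 x t = cons_tuple x t.
Proof.
apply: eq_from_tnth => j; case: (unliftP ord0 j) => [j' ->|->].
  by rewrite tnth_insert_lift tnthS.
by rewrite tnth_insert_id tnth0.
Qed.

Lemma insert_tupleS k (i : 'I_k.+1) x y (t : k.-tuple T) :
  insert_tuple (lift ord0 i) x (cons_tuple y t) = cons_tuple y (insert_tuple i x t).
Proof.
apply: eq_from_tnth => j; case: (unliftP ord0 j) => [j' ->|->].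
  rewrite tnthS; case: (unliftP i j') => [j'' ->|->]; last by rewrite !tnth_insert_id.
  rewrite tnth_insert_lift.
  have -> : lift ord0 (lift i j'') = lift (lift ord0 i) (lift ord0 j'').
    by apply: val_inj; rewrite /= /bump /= !add1n ltnS; case: leqP; rewrite ?add1n ?add0n.
  by rewrite tnth_insert_lift tnthS.
have -> : ord0 = lift (lift ord0 i) (ord0 : 'I_k.+1) by apply: val_inj.
by rewrite tnth_insert_lift !tnth0.
Qed.

Lemma measurable_insert_tuple k (i : 'I_k.+1) :
  measurable_fun setT (fun p : T * k.-tuple T => insert_tuple i p.1 p.2).
Proof.
apply/measurable_fun_tnthP => j /=; case: (unliftP i j) => [j' ->|->].
  rewrite [X in measurable_fun _ X](_ : _ = fun p => tnth p.2 j').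
    exact: (measurableT_comp (measurable_tnth _)).
  by apply/funext => p /=; rewrite tnth_insert_lift.
rewrite [X in measurable_fun _ X](_ : _ = fst)//.
by apply/funext => p /=; rewrite tnth_insert_id.
Qed.

(** Any coordinate may be made the outermost one; this later isolates one [v_i] or one sample point.
    When [i] lies beyond the head, Tonelli exchanges the head with the inserted variable. *)
Lemma iterint_insert k (i : 'I_k.+1) (F : k.+1.-tuple T -> \bar R) :
  measurable_fun setT F -> (forall t, 0 <= F t) ->
  iterint F = \int[mu]_x iterint (fun t => F (insert_tuple i x t)).
Proof.
elim: k i F => [|k ih] i F mF F0; case: (unliftP ord0 i) => [i' ->|->].
- by case: i'.
- by apply: eq_integral => x _ /=; rewrite insert_tuple0.
- transitivity (\int[mu]_y \int[mu]_x
      iterint (fun t => F (cons_tuple y (insert_tuple i' x t)))).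
    apply: eq_integral => y _.
    exact: (ih i' (fun t => F (cons_tuple y t)) (measurable_consx y mF)).
  rewrite (fubini_tonelli (fun p : T * T =>
    iterint (fun t => F (cons_tuple p.1 (insert_tuple i' p.2 t))))) /=.
  + apply: eq_integral => x _; apply: eq_integral => y _.
    by congr iterint; apply/funext => t; rewrite insert_tupleS.
  + apply: measurable_iterint => //.
    apply: (measurableT_comp mF); apply: measurable_fun_cons_tuple.
      exact: measurableT_comp.
    apply: (measurableT_comp (measurable_insert_tuple i')
      (g := fun q : (T * T) * k.-tuple T => (q.1.2, q.2))).
    by apply/measurable_fun_pair => //; exact: measurableT_comp.
  + by move=> p; exact: iterint_ge0.
- by under [RHS]eq_integral do under eq_fun do rewrite insert_tuple0.
Qed.

End iterated_integral.

(** * Product laws on tuples, characterised by their values on boxes *)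

Section product_law.
Context {R : realType} {disp : measure_display} {T : measurableType disp}.
Local Open Scope ereal_scope.

Lemma measurable_box k (A : 'I_k -> set T) : (forall j, measurable (A j)) ->
  measurable [set x : k.-tuple T | forall j, A j (tnth x j)].
Proof.
move=> mA; rewrite [X in measurable X](_ : _ =
    \bigcap_(j in [set: 'I_k]) ((fun x : k.-tuple T => tnth x j) @^-1` A j)).
  apply: fin_bigcap_measurable => // j _.
  by rewrite -[X in measurable X]setTI; apply: measurable_tnth.
by apply/seteqP; split => x /= Ax j; [move=> _; exact: Ax|exact: (Ax j I)].
Qed.

(** Boxes are stable under intersection and generate the sigma-algebra of tuples. *)
Lemma tuple_measure_unique k (m1 m2 : probability (k.-tuple T) R) :
  (forall A : 'I_k -> set T, (forall j, measurable (A j)) ->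
    m1 [set x | forall j, A j (tnth x j)] = m2 [set x | forall j, A j (tnth x j)]) ->
  forall B, measurable B -> m1 B = m2 B.
Proof.
move=> m12 B mB.
pose G : set (set (k.-tuple T)) := [set B | exists2 A : 'I_k -> set T,
  (forall j, measurable (A j)) & B = [set x | forall j, A j (tnth x j)]].
have GT : G setT.
  by exists (fun=> setT) => [//|]; apply/seteqP; split.
apply: (g_sigma_algebra_measure_unique G _ (fun=> setT)) => //.
- by move=> _ [A mA ->]; exact: measurable_box.
- by rewrite bigcup_const.
- move=> _ _ [A mA ->] [A' mA' ->]; exists (fun j => A j `&` A' j).
    by move=> j; exact: measurableI.
  apply/seteqP; split => [x /= [Ax A'x] j|x /= AA'x]; first by split.
  by split=> j; have [] := AA'x j.
- by move=> _ [A mA ->]; exact: m12.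
- by move=> _ /=; rewrite probability_setT ltry.
(* The given generators are cylinders over one coordinate, that is, boxes whose other sides are
   [setT]. *)
- move: B mB; apply: smallest_sub; first exact: smallest_sigma_algebra.
  rewrite -bigcup_seq => X /= [i _ [Y mY <-]].
  apply: sub_sigma_algebra; exists (fun j => if j == i then Y else setT).
    by move=> j; case: ifP.
  apply/seteqP; split => [x /= [_ Yx] j|x /= /(_ i)]; last by rewrite eqxx.
  by case: eqP => // ->.
Qed.

Variable mu : probability T R.

(** The witness is the image of [mu \x Q] under consing, with [Q] the law one dimension lower. It
    serves as the reference measure for laws known only through their values on boxes. *)
Lemma product_law_exists k : exists Q : probability (k.-tuple T) R,
  forall F : k.-tuple T -> \bar R, measurable_fun setT F ->
    (forall t, 0 <= F t) -> \int[Q]_t F t = iterint mu F.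
Proof.
elim: k => [|k [Q hQ]].
  exists (\d_ ([tuple] : 0.-tuple T)) => F mF F0.
  by rewrite integral_dirac// diracT mul1e.
pose c (p : T * k.-tuple T) := cons_tuple p.1 p.2.
have mc : measurable_fun setT c by exact: measurable_fun_cons_tuple.
pose c' : {mfun (T * k.-tuple T)%type >-> k.+1.-tuple T} :=
  HB.pack c (isMeasurableFun.Build _ _ _ _ _ mc).
exists (distribution (mu \x Q) c') => F mF F0.
rewrite ge0_integral_distribution//= fubini_tonelli1//=; last first.
  exact: measurableT_comp.
apply: eq_integral => x _; rewrite /fubini_F hQ//.
exact: measurable_consx.
Qed.

(** By uniqueness on boxes, [nu] is the reference product law. The indicator of a box is a product
    of one-coordinate indicators, so [iterint_prod] computes its integral. *)
Lemma integral_product_law k (nu : probability (k.-tuple T) R) :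
  (forall A : 'I_k -> set T, (forall j, measurable (A j)) ->
    nu [set x | forall j, A j (tnth x j)] = \prod_(j < k) mu (A j)) ->
  forall F : k.-tuple T -> \bar R, measurable_fun setT F ->
    (forall t, 0 <= F t) -> \int[nu]_t F t = iterint mu F.
Proof.
move=> nuE F mF F0; have [Q hQ] := product_law_exists k.
rewrite -hQ//; apply: eq_measure_integral => B mB _.
apply: tuple_measure_unique => // A mA; rewrite nuE//.
have mAA := measurable_box mA.
transitivity (\int[Q]_t (\1_[set x : k.-tuple T | forall j, A j (tnth x j)] t)%:E);
  last by rewrite integral_indic// setIT.
rewrite hQ//; last exact/measurable_EFinP/measurable_indic.
transitivity (iterint mu (fun t : k.-tuple T =>
    (\prod_(j < k) (\1_(A j) (tnth t j) : R))%:E)).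
  rewrite (@iterint_prod _ _ _ mu k (fun j => \1_(A j)))//.
  by apply: eq_bigr => j _; rewrite integral_indic// setIT.
congr iterint; apply/funext => t; congr EFin; rewrite indicE.
have [tA|tA] := boolP (t \in _).
  by rewrite big1// => j _; rewrite indicE mem_set//; move: tA; rewrite inE => /(_ j).
have [j Aj] : exists j, ~ A j (tnth t j).
  by apply/existsNP => h; move/negP: tA; apply; rewrite inE.
by rewrite (bigD1 j)//= indicE memNset// mul0r.
Qed.

End product_law.

(** * One-dimensional substitutions *)

Section density.
Context {R : realType} {disp disp' : measure_display}.
Context {S : measurableType disp} {T : measurableType disp'}.
Variables (nu : {measure set S -> \bar R}) (phi : S -> T) (w : S -> R).
Hypotheses (mphi : measurable_fun setT phi) (mw : measurable_fun setT w).
Hypothesis w0 : forall x, 0 <= w x.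
Local Open Scope ereal_scope.

(** The image under [phi] of the measure with density [w] with respect to [nu]. *)
Definition density_image (A : set T) := \int[nu]_(x in phi @^-1` A) (w x)%:E.

Let measurable_preimage_phi (A : set T) : measurable A -> measurable (phi @^-1` A).
Proof. by move=> mA; rewrite -[X in measurable X]setTI; exact: mphi. Qed.

Let density_image0 : density_image set0 = 0.
Proof. by rewrite /density_image preimage_set0 integral_set0. Qed.

Let density_image_ge0 A : 0 <= density_image A.
Proof. by apply: integral_ge0 => x _; rewrite lee_fin. Qed.

Let density_image_sigma_additive : semi_sigma_additive density_image.
Proof.
move=> F mF tF mUF; rewrite /density_image preimage_bigcup.
rewrite ge0_integral_bigcup//=.
- apply: is_cvg_nneseries => n _ _; exact: density_image_ge0.
- by move=> k; exact: measurable_preimage_phi.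
- exact/measurable_EFinP/measurable_funTS.
- by move=> x _; rewrite lee_fin.
- apply/trivIsetP => i j _ _ ij; rewrite -preimage_setI.
  by move/trivIsetP: tF => ->//; rewrite preimage_set0.
Qed.

HB.instance Definition _ := isMeasure.Build _ _ _ density_image
  density_image0 density_image_ge0 density_image_sigma_additive.

Import HBNNSimple.

(** Monotone convergence reduces the formula to simple functions, additivity to indicators, and for
    an indicator it is the definition of the measure. *)
Lemma integral_density_image (f : T -> \bar R) :
  measurable_fun setT f -> (forall x, 0 <= f x) ->
  \int[density_image]_x f x = \int[nu]_x (f (phi x) * (w x)%:E).
Proof.
move=> mf f0; pose f_ := nnsfun_approx measurableT mf.
transitivity (limn (fun n => \int[density_image]_x (f_ n x)%:E)).
  rewrite -monotone_convergence//=.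
  - by apply: eq_integral => x _; apply/esym/cvg_lim => //; exact: cvg_nnsfun_approx.
  - by move=> n; exact/measurable_EFinP.
  - by move=> n x _; rewrite lee_fin.
  - by move=> x _ m n mn; rewrite lee_fin; exact/lefP/nd_nnsfun_approx.
transitivity (limn (fun n => \int[nu]_x (f_ n (phi x) * w x)%:E)); last first.
  rewrite -monotone_convergence//=.
  - apply: eq_integral => x _; apply/cvg_lim => //.
    under eq_fun do rewrite EFinM.
    apply: cvgeZr => //; exact: (cvg_nnsfun_approx measurableT mf).
  - move=> n; apply/measurable_EFinP; apply: measurable_funM => //.
    exact: measurableT_comp.
  - by move=> n x _; rewrite lee_fin mulr_ge0.
  - move=> x _ m n mn; rewrite lee_fin ler_wpM2r//.
    exact/lefP/nd_nnsfun_approx.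
congr (limn _); apply/funext => n.
transitivity (\sum_(y \in range (f_ n))
    \int[density_image]_x (y * \1_(f_ n @^-1` [set y]) x)%:E).
  rewrite -ge0_integral_fsum//.
  - by apply: eq_integral => x _; rewrite fsumEFin// -fimfunE.
  - by move=> y; exact/measurable_EFinP/measurable_funM.
  - by move=> y x _; rewrite nnfun_muleindic_ge0.
transitivity (\sum_(y \in range (f_ n))
    \int[nu]_x (y * \1_(f_ n @^-1` [set y]) (phi x) * w x)%:E); last first.
  rewrite -ge0_integral_fsum//.
  - apply: eq_integral => x _; rewrite fsumEFin// [in RHS]fimfunE.
    congr EFin; rewrite !fsbig_finite//= mulr_suml.
    by apply: eq_bigr.
  - move=> y; apply/measurable_EFinP; apply: measurable_funM => //.
    by apply: measurable_funM => //; apply: measurableT_comp => //.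
  - move=> y x _; rewrite EFinM mule_ge0 ?lee_fin// -lee_fin.
    exact: nnfun_muleindic_ge0.
apply: eq_fsbigr => y _.
have [y0|y0] := leP 0%R y; last first.
  rewrite !integral0_eq// => x _; rewrite preimage_nnfun0// indic0 ?mulr0 ?mul0r//.
under [LHS]eq_integral do rewrite EFinM.
rewrite [LHS]ge0_integralZl_EFin//; last exact/measurable_EFinP.
under [RHS]eq_integral do rewrite -mulrA EFinM.
rewrite [RHS]ge0_integralZl_EFin//; last 2 first.
- by move=> x _; rewrite lee_fin mulr_ge0.
- apply/measurable_EFinP; apply: measurable_funM => //.
  by apply: measurableT_comp => //.
congr (_ * _); rewrite integral_indic// setIT [LHS]/= /density_image.
rewrite [LHS]integral_mkcond; apply: eq_integral => x _.
rewrite patchE indicE; case: ifPn => h.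
  by rewrite mem_set ?mul1r//; rewrite inE in h.
by rewrite memNset ?mul0r//; move/negP: h => h; apply: contra_not h; rewrite inE.
Qed.

(** The measure structure depends on the proofs about [phi] and [w]; the existential hands it over
    together with its integral formula. *)
Lemma density_image_measure : exists m : {measure set T -> \bar R},
  (forall A, m A = \int[nu]_(x in phi @^-1` A) (w x)%:E) /\
  forall f : T -> \bar R, measurable_fun setT f -> (forall x, 0 <= f x) ->
    \int[m]_x f x = \int[nu]_x (f (phi x) * (w x)%:E).
Proof. by exists density_image; split=> // f; exact: integral_density_image. Qed.

End density.

Section lebesgue_substitution.
Context {R : realType}.
Local Notation leb := (@lebesgue_measure R).
Local Open Scope ereal_scope.

Lemma measurable_affine (a b : R) : measurable_fun setT (fun x : R => (a * x + b)%R).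
Proof. by apply: measurable_funD => //; apply: measurable_funM. Qed.

(** On a half-open interval, the image under [x |-> a * x + b] of [a] times Lebesgue measure has the
    value of Lebesgue measure, hence the two measures coincide. *)
Lemma integral_affine (a b : R) (f : R -> \bar R) : (0 < a)%R ->
  measurable_fun setT f -> (forall x, 0 <= f x) ->
  \int[leb]_x f (a * x + b)%R = a^-1%:E * \int[leb]_x f x.
Proof.
move=> a0 mf f0.
pose phi (x : measurableTypeR R) : measurableTypeR R := (a * x + b)%R.
have mphi : measurable_fun setT phi by exact: measurable_affine.
have [m [mE mint]] := density_image_measure leb mphi (measurable_cst a) (fun=> ltW a0).
have lm A : measurable A -> leb A = m A.
  apply: lebesgue_measure_unique => _ [[u v]] _ <-; rewrite [RHS]mE.
  rewrite (eq_integral (cst a%:E))// integral_cst//; last first.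
    by rewrite -[X in measurable X]setTI; exact: mphi.
  rewrite [X in _ = _ * _ X](_ : _ = `](u - b) / a, (v - b) / a]%classic)%R; last first.
    apply/seteqP; split => x /=; rewrite !in_itv/= /phi ltr_pdivrMr// ler_pdivlMr//.
      by rewrite ltrBlDr lerBrDr (mulrC x).
    by rewrite ltrBlDr lerBrDr (mulrC x).
  rewrite [X in _ = _ * X](lebesgue_measure_itv `](u - b) / a, (v - b) / a]%R).
  rewrite lebesgue_measure_itv/= !lte_fin ltr_pM2r ?invr_gt0// ltrD2r.
  case: ifPn => _; last by rewrite mule0.
  by rewrite -!EFinB -EFinM; congr EFin; field; rewrite gt_eqF.
have -> : \int[leb]_x f x = \int[m]_x f x.
  by apply: eq_measure_integral => A mA _; exact: lm.
rewrite mint// [X in _ = _ * X](eq_integral (fun x => f (phi x) * a%:E))//.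
rewrite ge0_integralZr//; last 2 first.
- exact: measurableT_comp.
- by rewrite lee_fin ltW.
by rewrite muleCA -EFinM mulVf ?mule1// gt_eqF.
Qed.

Lemma integral_oppr (f : R -> \bar R) :
  measurable_fun setT f -> (forall x, 0 <= f x) ->
  \int[leb]_x f (- x)%R = \int[leb]_x f x.
Proof.
move=> mf f0.
rewrite [RHS](@eq_measure_integral _ _ _ _ (pushforward leb (-%R : _ -> measurableTypeR R))).
  by rewrite ge0_integral_pushforward.
by move=> A mA _; exact/esym/lebesgue_measureN.
Qed.

Lemma integral_shift (b : R) (f : R -> \bar R) :
  measurable_fun setT f -> (forall x, 0 <= f x) ->
  \int[leb]_x f (x + b)%R = \int[leb]_x f x.
Proof.
move=> mf f0; have := @integral_affine 1 b f ltr01 mf f0.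
by rewrite invr1 mul1e => <-; apply: eq_integral => x _; rewrite mul1r.
Qed.

Lemma integral_reflect (b : R) (f : R -> \bar R) :
  measurable_fun setT f -> (forall x, 0 <= f x) ->
  \int[leb]_x f (b - x)%R = \int[leb]_x f x.
Proof.
move=> mf f0; transitivity (\int[leb]_x f (x + b)%R); last exact: integral_shift.
rewrite -(integral_oppr (f := fun x => f (x + b)%R))//.
  by apply: eq_integral => x _; rewrite addrC.
by apply: measurableT_comp => //; exact: measurable_funD.
Qed.

Lemma integral_expR_itv (u v : R) : (u <= v)%R ->
  \int[leb]_(x in `]u, v]) (expR x)%:E = (expR v - expR u)%:E.
Proof.
rewrite le_eqVlt => /predU1P[->|uv].
  by rewrite set_itvoc0 integral_set0 subrr.
rewrite integral_itv_obnd_cbnd; last by apply/measurable_EFinP/measurable_funTS.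
rewrite (@continuous_FTC2 _ _ expR)//.
- by apply: continuous_subspaceT => x; exact: continuous_expR.
- split.
  + by move=> x _; exact: derivable_expR.
  + by apply: cvg_at_right_filter; exact: continuous_expR.
  + by apply: cvg_at_left_filter; exact: continuous_expR.
- by move=> x _; rewrite derive1E; have /funeqP -> := @derive_expR R.
Qed.

(** Two measures on the line are compared: [exp u du], and the image under [ln] of Lebesgue measure
    on the positive half-line. Both give [exp b - exp a] to []a, b]], so they agree, and integrating
    [f \o expR] against them yields the two sides. *)
Lemma integral_expR_subst (f : R -> \bar R) :
  measurable_fun setT f -> (forall x, 0 <= f x) ->
  \int[leb]_u (f (expR u) * (expR u)%:E) = \int[leb]_(x in `]0%R, +oo[) f x.
Proof.
move=> mf f0.
have mln : measurable_fun setT (@ln R : measurableTypeR R -> measurableTypeR R).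
  exact: measurable_ln.
pose w : R -> R := \1_(`]0%R, +oo[%classic).
have mw : measurable_fun setT w by exact: measurable_indic.
have w0 x : (0 <= w x)%R by [].
have [m [mE mint]] := density_image_measure leb mln mw w0.
have [m' [m'E m'int]] := density_image_measure leb
  (@measurable_id _ (measurableTypeR R) setT) (@measurable_expR R) (@expR_ge0 R).
have m'oc (a b : R) : (a <= b)%R -> m' `]a, b]%classic = (expR b - expR a)%:E.
  by move=> ab; rewrite m'E preimage_id integral_expR_itv.
have mm' (A : set (measurableTypeR R)) : measurable A -> m' A = m A.
  apply: (@measure_unique _ _ (measurableTypeR R) (@ocitv R)
    (fun k => `](- k%:R)%R, k%:R]%classic)) => //.
  - exact: ocitvI.
  - by move=> k; exact: is_ocitv.
  - exact: bigcup_itvT.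
  - move=> _ [[a b] _ <-] /=; have [ab|ba] := leP a b; last first.
      have -> : [set` `]a, b]] = set0 :> set (measurableTypeR R).
        by apply: set_itv_ge; rewrite bnd_simp -leNgt ltW.
      by rewrite !measure0.
    rewrite m'oc// mE.
    transitivity (leb `]expR a, expR b]%classic).
      rewrite lebesgue_measure_itv/= lte_fin ltr_expR.
      move: ab; rewrite le_eqVlt => /predU1P[->|->]; last by rewrite -EFinB.
      by rewrite subrr ltxx.
    transitivity (\int[leb]_x (\1_(`]expR a, expR b]%classic) x)%:E).
      by rewrite integral_indic// setIT.
    rewrite [RHS]integral_mkcond.
    apply: eq_integral => x _; rewrite patchE !indicE /w.
    (* At nonpositive reals [ln] only has a default value; the density [w] vanishes there. *)
    have [x0|x0] := leP x 0%R.
      rewrite memNset; last first.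
        by rewrite /= in_itv/= => /andP[+ _]; rewrite ltNge (le_trans x0)// expR_ge0.
      case: ifP => // _; rewrite indicE memNset//= in_itv/= andbT.
      by apply/negP; rewrite -leNgt.
    have lnx : (x \in (@ln R @^-1` `]a, b]%classic)) = (x \in `]expR a, expR b]%classic).
      have ex : expR (ln x) = x by rewrite lnK.
      have h : (a < ln x <= b)%R = (expR a < x <= expR b)%R.
        by rewrite -[in RHS]ex ltr_expR ler_expR.
      by apply/idP/idP => /set_mem hx; apply/mem_set; move: hx;
        rewrite /= !in_itv/= h.
    rewrite lnx; case: ifP => // _.
    by rewrite indicE mem_set//= in_itv/= x0.
  - move=> k; rewrite m'oc ?ltry// (@le_trans _ _ 0%R)// oppr_le0//.
have mfe : measurable_fun setT (f \o expR) by exact: measurableT_comp.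
have fe0 x : 0 <= (f \o expR) x by exact: f0.
rewrite -(m'int _ mfe fe0).
rewrite (eq_measure_integral m); last by move=> A mA _; exact: mm'.
rewrite (mint _ mfe fe0).
rewrite [RHS]integral_mkcond; apply: eq_integral => x _ /=; rewrite patchE /w indicE.
case: ifPn => h; last by rewrite mule0.
by rewrite mule1 lnK//; move: h; rewrite inE /= in_itv /= andbT.
Qed.

End lebesgue_substitution.

(** * The Gamma integral and related integrals in the logarithmic variable *)

Section gamma_log_integrals.
Context {R : realType}.
Local Notation leb := (@lebesgue_measure R).
Local Open Scope ereal_scope.

(* The integrand [t^(s-1) * exp(-c*t) dt] in the variable [t = exp u]. *)
Definition gumbel_exp (s c u : R) : R := expR (s * u - c * expR u).

Lemma gumbel_exp_ge0 s c u : (0 <= gumbel_exp s c u)%R.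
Proof. exact: expR_ge0. Qed.

Lemma measurable_gumbel_exp s c : measurable_fun setT (gumbel_exp s c).
Proof.
apply: measurableT_comp => //; apply: measurable_funB; apply: measurable_funM => //.
Qed.

Lemma measurable_ler_l (rho : R) : measurable_fun setT (fun u : R => (u <= rho)%R%:R : R).
Proof.
have -> : (fun u : R => (u <= rho)%R%:R : R) = \1_(`]-oo, rho]%classic).
  apply/funext => u; rewrite indicE; congr (nat_of_bool _)%:R.
  by apply/idP/idP => h; [apply/mem_set; rewrite /= in_itv|
    move/set_mem: h; rewrite /= in_itv].
exact: measurable_indic.
Qed.

Lemma measurable_half_exp (s rho : R) :
  measurable_fun setT (fun u : R => ((u <= rho)%R%:R * expR (s * u))%R).
Proof.
apply: measurable_funM; first exact: measurable_ler_l.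
by apply: measurableT_comp => //; exact: measurable_funM.
Qed.

Let mG s c : measurable_fun setT (fun u => (gumbel_exp s c u)%:E).
Proof. by apply/measurable_EFinP; exact: measurable_gumbel_exp. Qed.

Let G0 s c u : 0 <= (gumbel_exp s c u)%:E.
Proof. by rewrite lee_fin gumbel_exp_ge0. Qed.

Let mH s rho : measurable_fun setT (fun u : R => ((u <= rho)%R%:R * expR (s * u))%:E).
Proof. by apply/measurable_EFinP; exact: measurable_half_exp. Qed.

Let H0 s rho (u : R) : 0 <= ((u <= rho)%R%:R * expR (s * u))%:E.
Proof. by rewrite lee_fin mulr_ge0// expR_ge0. Qed.

#[local] Hint Resolve mG G0 mH H0 : core.

Local Ltac meas := try solve [exact: mG | exact: mH
  | apply: emeasurable_funD; solve [exact: mG | exact: mH | apply: measurable_funeM; exact: mG]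
  | apply: measurable_funeM; exact: mG].

(** Through [x = exp u] this is the length of []0, 1]]. *)
Lemma integral_half_exp1 :
  \int[leb]_u ((u <= 0)%R%:R * expR u)%:E = 1.
Proof.
have /= := @integral_expR_subst R (fun x => ((x <= 1)%R%:R : R)%:E).
rewrite (_ : \int[leb]_(x in `]0%R, +oo[) _ = 1); last first.
  transitivity (leb `]0%R, 1%R]%classic).
    rewrite -[X in leb X]setIT.
    rewrite -(integral_indic leb measurableT)// [LHS]integral_mkcond [RHS]integral_mkcond.
    apply: eq_integral => x _; rewrite !patchE in_setT indicE; case: ifPn => h.
      move/set_mem: h; rewrite /= in_itv/= andbT => x0; congr ((nat_of_bool _)%:R)%:E.
      by apply/idP/idP => h; [apply/mem_set; rewrite /= in_itv/= x0|
        move/set_mem: h; rewrite /= in_itv/= => /andP[]].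
    rewrite memNset//= in_itv/= => /andP[x0 _].
    by move/negP: h; apply; apply/mem_set; rewrite /= in_itv/= x0.
  by rewrite lebesgue_measure_itv/= lte_fin ltr01 oppr0 adde0.
move=> <-.
- apply: eq_integral => u _; rewrite -EFinM.
  by have -> : (expR u <= 1)%R = (u <= 0)%R by rewrite -[in RHS]ler_expR expR0.
- apply/measurable_EFinP; exact: measurable_ler_l.
- by move=> x; rewrite lee_fin.
Qed.

Lemma integral_half_exp (s rho : R) : (0 < s)%R ->
  \int[leb]_u ((u <= rho)%R%:R * expR (s * u))%:E = (expR (s * rho) / s)%:E.
Proof.
move=> s0.
have mh : measurable_fun setT (fun u : R => ((u <= 0)%R%:R * expR u)%:E).
  apply/measurable_EFinP; apply: measurable_funM => //; exact: measurable_ler_l.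
have h0 (u : R) : 0 <= ((u <= 0)%R%:R * expR u)%:E.
  by rewrite lee_fin mulr_ge0// expR_ge0.
have := @integral_affine R s (- (s * rho))%R _ s0 mh h0.
rewrite integral_half_exp1 mule1 EFinM => <-.
have mh' := measurableT_comp mh (measurable_affine s (- (s * rho))).
rewrite -ge0_integralZl// ?lee_fin ?expR_ge0//.
apply: eq_integral => u _; rewrite -EFinM; congr EFin.
rewrite subr_le0 ler_pM2l// [RHS]mulrCA -expRD; congr (_ * expR _)%R; ring.
Qed.

Lemma integral_gumbel_exp1 (c : R) : (0 < c)%R ->
  \int[leb]_u (gumbel_exp 1 c u)%:E = c^-1%:E.
Proof.
move=> c0.
have mh : measurable_fun setT (fun u : R => ((u <= 0)%R%:R * expR (c * u))%:E).
  apply/measurable_EFinP; exact: measurable_half_exp.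
have h0 (u : R) : 0 <= ((u <= 0)%R%:R * expR (c * u))%:E.
  by rewrite lee_fin mulr_ge0// expR_ge0.
have me : measurable_fun setT (fun x : R => (expR (- (c * x)))%:E).
  apply/measurable_EFinP; apply: measurableT_comp => //.
  by apply: measurable_funN; exact: measurable_funM.
transitivity (\int[leb]_(x in `]0%R, +oo[) (expR (- (c * x)))%:E).
  rewrite -(integral_expR_subst me) => [|x]; last by rewrite lee_fin expR_ge0.
  apply: eq_integral => u _; rewrite -EFinM -expRD /gumbel_exp mul1r.
  by congr (expR _)%:E; ring.
rewrite integral_itv_obnd_cbnd; last exact: measurable_funTS.
have := integral_half_exp 0 c0; rewrite mulr0 expR0 mul1r => <-.
rewrite -(integral_oppr mh h0) [LHS]integral_mkcond; apply: eq_integral => x _.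
rewrite patchE oppr_le0 mulrN; case: ifPn => hx.
  by move/set_mem: hx; rewrite /= in_itv/= andbT => ->; rewrite mul1r.
case: (leP 0%R x) => x0; last by rewrite mul0r.
by move/negP: hx; case; apply/mem_set; rewrite /= in_itv/= x0.
Qed.

(** Euler's integral for [Gamma s], kept as an extended real so that integrals can be compared
    before finiteness is known. *)
Definition gamma_log_int (s : R) := \int[leb]_u (gumbel_exp s 1 u)%:E.

Lemma gamma_log_int_ge0 s : 0 <= gamma_log_int s.
Proof. by apply: integral_ge0 => u _; rewrite lee_fin gumbel_exp_ge0. Qed.

(** The integrand is at most [exp (s * u)] for [u <= 0] and at most [exp (u - exp u)] for [u > 0].
    The bound supplies the finiteness behind [gamma_log_int_Gamma]. *)
Lemma gamma_log_int_le s : (0 < s <= 1)%R -> gamma_log_int s <= (s^-1 + 1)%:E.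
Proof.
move=> /andP[s0 s1].
have := integral_half_exp 0 s0; rewrite mulr0 expR0 mul1r EFinD => <-.
have := integral_gumbel_exp1 ltr01; rewrite invr1 => <-.
rewrite /gamma_log_int -ge0_integralD//; meas; apply: ge0_le_integral => //; meas.
move=> u _; rewrite -EFinD lee_fin /gumbel_exp; have [u0|u0] := leP u 0%R.
  by rewrite !mul1r -[leLHS]addr0 lerD ?expR_ge0// ler_expR gerBl expR_ge0.
by rewrite mul0r add0r ler_expR lerD2r ler_wpM2r// ltW.
Qed.

(** On [u <= 0], [exp (- exp u) >= 1 - exp u]; integrating against [exp (s * u)] gives
    [1/s - 1/(1+s)]. *)
Lemma gamma_log_int_ge s : (0 < s)%R -> s^-1%:E <= gamma_log_int s + (1 + s)^-1%:E.
Proof.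
move=> s0; have s1 : (0 < 1 + s)%R by rewrite addr_gt0.
have := integral_half_exp 0 s0; rewrite mulr0 expR0 mul1r => <-.
have := integral_half_exp 0 s1; rewrite mulr0 expR0 mul1r => <-.
rewrite /gamma_log_int -ge0_integralD//; meas; apply: ge0_le_integral => //; meas.
move=> u _; rewrite -EFinD lee_fin /gumbel_exp; have [u0|u0] := leP u 0%R; last first.
  by rewrite !mul0r addr0 expR_ge0.
rewrite !mul1r mulrDl mul1r !expRD.
have := expR_ge1Dx (- expR u); have := expR_gt0 (s * u).
move: (expR (s * u)) (expR u) (expR (- expR u)) => x y z; nra.
Qed.

Lemma expR_scale_le (s u : R) : (0 <= s <= 1)%R -> (expR (s * u) <= 1 + expR u)%R.
Proof.
move=> /andP[s0 s1]; have [u0|u0] := leP u 0%R.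
  apply: (@le_trans _ _ (expR 0)); last by rewrite expR0 lerDl expR_ge0.
  by rewrite ler_expR mulr_ge0_le0.
apply: (@le_trans _ _ (expR u)); last by rewrite lerDr.
by rewrite ler_expR ler_piMl// ltW.
Qed.

(** Half of the decay absorbs the extra power: [exp (s * u) <= 1 + exp u <= (2/c) * exp (c/2 * exp
    u)], and what is left integrates to [2/c]. The bound is uniform in [s]; it is used with [c = 1],
    giving 4, and with [c = 1/4], giving 64. *)
Lemma integral_gumbel_exp_le s c : (0 <= s <= 1)%R -> (0 < c <= 2)%R ->
  \int[leb]_u (gumbel_exp (1 + s) c u)%:E <= (4 / c ^+ 2)%:E.
Proof.
move=> s01 /andP[c0 c2]; have c20 : (0 < c / 2)%R by rewrite divr_gt0.
have -> : ((4 / c ^+ 2)%:E : \bar R) = (2 / c)%:E * ((c / 2)^-1)%:E.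
  by rewrite -EFinM; congr EFin; field; rewrite gt_eqF.
rewrite -integral_gumbel_exp1// -ge0_integralZl// ?lee_fin ?divr_ge0 ?(ltW c0)//; meas.
apply: ge0_le_integral => //; meas.
move=> u _; rewrite -EFinM lee_fin /gumbel_exp.
have -> : ((1 + s) * u - c * expR u = s * u + (u - c * expR u))%R by ring.
have -> : (1 * u - c / 2 * expR u = c / 2 * expR u + (u - c * expR u))%R by field.
rewrite !(expRD _ (u - _)%R) mulrA ler_wpM2r ?expR_ge0//.
apply: (le_trans (expR_scale_le u s01)).
have h := expR_ge1Dx (c / 2 * expR u).
apply: (@le_trans _ _ (2 / c * (1 + c / 2 * expR u))%R); last first.
  by rewrite ler_wpM2l// divr_ge0// ltW.
have -> : (2 / c * (1 + c / 2 * expR u) = 2 / c + expR u)%R.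
  by field; rewrite gt_eqF.
by rewrite lerD2r ler_pdivlMr// mul1r.
Qed.

(** Pointwise this is [exp (a * u) <= 1 + a * exp u], a consequence of convexity of the
    exponential. *)
Lemma gamma_log_int_add_le s a : (0 <= a <= 1)%R ->
  gamma_log_int (s + a) <= gamma_log_int s + a%:E * gamma_log_int (1 + s).
Proof.
move=> /andP[a0 a1].
rewrite /gamma_log_int -ge0_integralZl//; meas; rewrite -ge0_integralD//; meas;
  last by move=> u _; rewrite mule_ge0.
apply: ge0_le_integral => //; meas.
move=> u _; rewrite -EFinM -EFinD lee_fin /gumbel_exp.
rewrite (_ : (s + a) * u - 1 * expR u = a * u + (s * u - 1 * expR u))%R; last by ring.
rewrite (_ : (1 + s) * u - 1 * expR u = u + (s * u - 1 * expR u))%R; last by ring.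
rewrite !(expRD _ (s * u - _)%R).
suff : (expR (a * u) <= 1 + a * expR u)%R.
  move=> h; rewrite mulrA -[X in (_ <= X + _)%R]mul1r -mulrDl.
  by rewrite ler_wpM2r ?expR_ge0.
have h1 := expR_ge1Dx (u - a * u); have h2 := expR_ge1Dx (- (a * u)).
have e1 : expR u = (expR (u - a * u) * expR (a * u))%R by rewrite -expRD subrK.
have e2 : (expR (- (a * u)) * expR (a * u) = 1)%R by rewrite -expRD addNr expR0.
have e0 := expR_gt0 (a * u).
(* Two tangent-line bounds, averaged with weights [1 - a] and [a] so that the linear terms cancel;
   multiplying by [exp (a * u)] gives the claim. *)
have : (1 <= (1 - a) * expR (- (a * u)) + a * expR (u - a * u))%R by nra.
rewrite e1; move: e2 e0.
move: (expR (u - a * u)) (expR (a * u)) (expR (- (a * u))) => x y z e2 e0 h; nra.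
Qed.

Lemma gamma_log_int_Gamma s : (0 < s <= 1)%R -> (Gamma s)%:E = gamma_log_int s.
Proof.
move=> s01; have [s0 _] := andP s01.
have mf : measurable_fun setT (fun t : R => (t `^ (s - 1) * expR (- t))%:E).
  apply/measurable_EFinP; apply: measurable_funM; first exact: measurable_powR.
  by apply: measurableT_comp => //; exact: measurable_funN.
have E : \int[leb]_(t in `]0%R, +oo[) (t `^ (s - 1) * expR (- t))%:E = gamma_log_int s.
  rewrite -integral_expR_subst//; last first.
    by move=> t; rewrite lee_fin mulr_ge0 ?powR_ge0 ?expR_ge0.
  apply: eq_integral => u _; rewrite -EFinM; congr EFin.
  rewrite /powR gt_eqF ?expR_gt0// expRK -!expRD /gumbel_exp; congr expR; ring.
rewrite /Gamma /Rintegral E fineK// ge0_fin_numE ?gamma_log_int_ge0//.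
by rewrite (le_lt_trans (gamma_log_int_le s01))// ltry.
Qed.

End gamma_log_integrals.

(** * Logarithmic and dual coordinates *)

Section iterated_substitution.
Context {R : realType} {disp disp' : measure_display}.
Context {S : measurableType disp} {T : measurableType disp'}.
Variables (nu : {sigma_finite_measure set S -> \bar R}).
Variables (mu : {sigma_finite_measure set T -> \bar R}).
Variables (phi : S -> T) (w : S -> R).
Hypotheses (mphi : measurable_fun setT phi) (mw : measurable_fun setT w).
Hypothesis w0 : forall x, 0 <= w x.
Local Open Scope ereal_scope.
Hypothesis subst : forall f : T -> \bar R, measurable_fun setT f ->
  (forall x, 0 <= f x) -> \int[mu]_x f x = \int[nu]_x (f (phi x) * (w x)%:E).

Lemma measurable_map_tuple k :
  measurable_fun setT (fun t : k.-tuple S => map_tuple phi t).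
Proof.
apply/measurable_fun_tnthP => i /=.
rewrite [X in measurable_fun _ X](_ : _ = fun t => phi (tnth t i)).
  exact: (measurableT_comp mphi (measurable_tnth i)).
by apply/funext => t /=; rewrite tnth_map.
Qed.

Lemma measurable_prod_tnth k :
  measurable_fun setT (fun t : k.-tuple S => \prod_(i < k) w (tnth t i))%R.
Proof.
by apply: measurable_prod => i _; exact: (measurableT_comp mw (measurable_tnth i)).
Qed.

Lemma iterint_subst k (F : k.-tuple T -> \bar R) :
  measurable_fun setT F -> (forall t, 0 <= F t) ->
  iterint mu F =
  iterint nu (fun t => F (map_tuple phi t) * (\prod_(i < k) w (tnth t i))%:E).
Proof.
elim: k F => [|k ih] F mF F0 /=.
  by rewrite big_ord0 mule1; congr F; apply: val_inj.
rewrite subst; last 2 first.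
- exact: measurable_iterint_cons.
- by move=> x; exact: iterint_ge0.
apply: eq_integral => x _; rewrite ih//; last exact: measurable_consx.
rewrite muleC -iterintZl//.
- congr iterint; apply/funext => t; rewrite big_ord_recl tnth0 muleCA -EFinM.
  congr (F _ * _); first exact: val_inj.
  by congr (_ * _)%R%:E; apply: eq_bigr => i _; rewrite tnthS.
- apply: emeasurable_funM; last by apply/measurable_EFinP; exact: measurable_prod_tnth.
  apply: (measurableT_comp (measurable_consx (phi x) mF)).
  exact: measurable_map_tuple.
- by move=> t; rewrite mule_ge0// lee_fin prodr_ge0.
Qed.

End iterated_substitution.

(** * The linear change to dual coordinates *)

Section dual_coordinates.
Context {R : realType}.
Local Notation leb := (@lebesgue_measure R).
Local Open Scope ereal_scope.

Definition tsum k (t : k.-tuple R) : R := (\sum_(i < k) tnth t i)%R.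

Lemma measurable_tsum k : measurable_fun setT (@tsum k).
Proof. by apply: measurable_sum => i; exact: measurable_tnth. Qed.

(** The solution [u] of [v_i = L + \sum_(j != i) u_j]. With [L = ln n] and [u_i = ln x_i] it inverts
    the passage from [x] to [v]. *)
Definition dual_tuple (L : R) k (v : k.+1.-tuple R) : k.+1.-tuple R :=
  map_tuple (fun x => (tsum v - L) / k%:R - x)%R v.

Lemma tnth_dual (L : R) k (v : k.+1.-tuple R) i :
  tnth (dual_tuple L v) i = ((tsum v - L) / k%:R - tnth v i)%R.
Proof. by rewrite tnth_map. Qed.

Lemma measurable_dual_tuple (L : R) k : measurable_fun setT (@dual_tuple L k).
Proof.
apply/measurable_fun_tnthP => i /=.
rewrite [X in measurable_fun _ X](_ : _ =
  fun v => (tsum v - L) / k%:R - tnth v i)%R; last first.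
  by apply/funext => v /=; rewrite tnth_dual.
apply: measurable_funB; last exact: measurable_tnth.
by apply: measurable_funM => //; apply: measurable_funB => //; exact: measurable_tsum.
Qed.

(* The first coordinate is traded for the common shift [c = (tsum v - L) / k];
   for fixed [c] the other ones are merely reflected. *)
Lemma iterint_dual (L : R) k (H : k.+1.-tuple R -> \bar R) : (0 < k)%N ->
  measurable_fun setT H -> (forall t, 0 <= H t) ->
  iterint leb (fun v => H (dual_tuple L v)) = k%:R%:E * iterint leb H.
Proof.
move=> k0 mH H0; have k0' : (0 < k%:R :> R)%R by rewrite ltr0n.
(* For a given shift [c], the traded coordinate is [v_0 = k * c + L - tsum t]; the first entry is
   [c - v_0]. *)
pose K (c : R) (t : k.-tuple R) :=
  H (cons_tuple (tsum t - (k%:R - 1) * c - L)%R (map_tuple (fun x => c - x)%R t)).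
have K0 c t : 0 <= K c t by exact: H0.
have mK : measurable_fun setT (fun p : R * k.-tuple R => K p.1 p.2).
  apply: (measurableT_comp mH); apply: measurable_fun_cons_tuple.
    apply: measurable_funB => //; apply: measurable_funB.
      exact: (measurableT_comp (@measurable_tsum k)).
    exact: measurable_funM.
  apply/measurable_fun_tnthP => i /=.
  rewrite [X in measurable_fun _ X](_ : _ = fun p => p.1 - tnth p.2 i)%R.
    apply: measurable_funB => //; exact: (measurableT_comp (measurable_tnth i)).
  by apply/funext => p /=; rewrite tnth_map.
have mKx (t : k.-tuple R) : measurable_fun setT (K^~ t).
  exact: (measurableT_comp mK (measurable_pair2 t)).
transitivity (\int[leb]_x iterint leb
    (fun t => K (k%:R^-1 * x + (tsum t - L) / k%:R)%R t)).
  apply: eq_integral => x _; congr iterint; apply/funext => t; congr H.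
  have cE : ((tsum (cons_tuple x t) - L) / k%:R =
             k%:R^-1 * x + (tsum t - L) / k%:R)%R.
    rewrite /tsum big_ord_recl tnth0 -addrA mulrDl mulrC; congr (_ + (_ - _) / _)%R.
    by apply: eq_bigr => i _; rewrite tnthS.
  apply: val_inj; rewrite /= cE; congr cons.
  by field; rewrite gt_eqF.
have mg : measurable_fun setT (fun p : R * k.-tuple R =>
    ((k%:R^-1 * p.1 + (tsum p.2 - L) / k%:R)%R, p.2)).
  apply/measurable_fun_pair => //; apply: measurable_funD; first exact: measurable_funM.
  apply: measurable_funM => //; apply: measurable_funB => //.
  exact: (measurableT_comp (@measurable_tsum k)).
rewrite iterint_integral//; last exact: (measurableT_comp mK mg).
transitivity (iterint leb (fun t => k%:R%:E * \int[leb]_c K c t)).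
  congr iterint; apply/funext => t.
  by rewrite (@integral_affine R k%:R^-1 ((tsum t - L) / k%:R) (K^~ t)) ?invr_gt0// invrK.
rewrite iterintZl//; last 2 first.
- exact: (@measurable_fun_fubini_tonelli_G _ _ _ _ _ leb _ mK).
- by move=> t; apply: integral_ge0 => c _; exact: H0.
congr (_ * _); rewrite -iterint_integral//.
(* Reflection replaces [tsum t] by [k * c - tsum t], so the first entry now contains [c] with
   coefficient 1 and a translation removes the rest. *)
pose P (c : R) (t : k.-tuple R) := H (cons_tuple (c + (- tsum t - L))%R t).
have P0 c t : 0 <= P c t by exact: H0.
have mP : measurable_fun setT (fun p : R * k.-tuple R => P p.1 p.2).
  apply: (measurableT_comp mH); apply: measurable_fun_cons_tuple => //.
  apply: measurable_funD => //; apply: measurable_funB => //; apply: measurable_funN.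
  exact: (measurableT_comp (@measurable_tsum k)).
transitivity (\int[leb]_c iterint leb (P c)).
  apply: eq_integral => c _.
  rewrite [RHS](@iterint_subst _ _ _ _ _ leb leb (fun x => c - x)%R (fun=> 1%R))//.
  - congr iterint; apply/funext => t; rewrite big1// mule1 /P /K; congr (H (cons_tuple _ _)).
    rewrite /tsum; under [in RHS]eq_bigr do rewrite tnth_map.
    rewrite sumrB sumr_const card_ord -mulr_natr; ring.
  - exact: measurable_funB.
  - by move=> f mf f0; under [RHS]eq_integral do rewrite mule1; rewrite integral_reflect.
  - exact: (measurableT_comp mP (measurable_pair1 c)).
rewrite iterint_integral//.
transitivity (iterint leb (fun t => \int[leb]_x H (cons_tuple x t))).
  congr iterint; apply/funext => t.
  rewrite (@integral_shift R (- tsum t - L) (fun c => H (cons_tuple c t)))//.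
  exact: (measurableT_comp (measurable_consl mH) (measurable_pair2 t)).
by rewrite -iterint_integral//; exact: measurable_consl.
Qed.

End dual_coordinates.

(** * The main integral and the three error integrals in dual coordinates *)

Section tuple_integrals.
Context {R : realType}.
Local Notation leb := (@lebesgue_measure R).
Local Open Scope ereal_scope.

Let mE (f : R -> R) k (i : 'I_k) : measurable_fun setT f ->
  measurable_fun setT (fun t : k.-tuple R => f (tnth t i)).
Proof. by move=> mf; exact: (measurableT_comp mf (measurable_tnth i)). Qed.

Lemma measurable_prod_comp k (f : 'I_k -> R -> R) :
  (forall i, measurable_fun setT (f i)) ->
  measurable_fun setT (fun t : k.-tuple R => \prod_(i < k) f i (tnth t i))%R.
Proof. by move=> mf; apply: measurable_prod => i _; exact: mE. Qed.

Lemma measurable_ler_natr disp (T : measurableType disp) (f g : T -> R) :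
  measurable_fun setT f -> measurable_fun setT g ->
  measurable_fun setT (fun t => (f t <= g t)%R%:R : R).
Proof.
move=> mf mg; rewrite [X in measurable_fun _ X](_ : _ =
  fun t => if (f t <= g t)%R then 1%R else 0%R).
  by apply: measurable_fun_ifT => //; exact: measurable_fun_ler.
by apply/funext => t; case: ifP.
Qed.

Lemma prod_gumbel_exp (I : finType) (P : pred I) (s c : R) (v : I -> R) :
  (\prod_(i | P i) gumbel_exp s c (v i) =
   expR (s * (\sum_(i | P i) v i) - c * \sum_(i | P i) expR (v i)))%R.
Proof. by rewrite -expR_sum sumrB !mulr_sumr. Qed.

Lemma tsum_insert k (i : 'I_k.+1) (x : R) t : tsum (insert_tuple i x t) = (x + tsum t)%R.
Proof.
rewrite /tsum (bigD1_ord i)//= tnth_insert_id; congr (_ + _)%R.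
by apply: eq_bigr => j _; rewrite tnth_insert_lift.
Qed.

Lemma prod_insert k (i : 'I_k.+1) (f : R -> R) x t :
  (\prod_(j < k.+1) f (tnth (insert_tuple i x t) j) =
   f x * \prod_(j < k) f (tnth t j))%R.
Proof.
rewrite (bigD1_ord i)//= tnth_insert_id; congr (_ * _)%R.
by apply: eq_bigr => j _; rewrite tnth_insert_lift.
Qed.

Lemma prod_neq_lift k (i : 'I_k.+1) (G : 'I_k.+1 -> R) :
  (\prod_(j < k.+1 | j != i) G j = \prod_(j < k) G (lift i j))%R.
Proof.
rewrite big_mkcond (bigD1_ord i)//= eqxx mul1r; apply: eq_bigr => j _.
by rewrite eq_sym neq_lift.
Qed.

Lemma iterint_gumbel_exp k (s : R) :
  iterint leb (fun v : k.-tuple R => (\prod_(i < k) gumbel_exp s 1 (tnth v i))%:E) =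
  \prod_(i < k) gamma_log_int s.
Proof.
rewrite (@iterint_prod _ _ _ leb k (fun=> gumbel_exp s 1))//.
- by move=> i; exact: measurable_gumbel_exp.
- by move=> i x; exact: gumbel_exp_ge0.
Qed.

(** The factor [exp v_i] raises the exponent of a single coordinate from [s] to [1 + s]. Summed over
    [i], this is the error of the lower exponential approximation. *)
Lemma iterint_gumbel_exp_moment k (s : R) (i : 'I_k.+1) :
  iterint leb (fun v : k.+1.-tuple R =>
    (expR (tnth v i) * \prod_(j < k.+1) gumbel_exp s 1 (tnth v j))%:E) =
  gamma_log_int (1 + s) * \prod_(j < k) gamma_log_int s.
Proof.
pose f (j : 'I_k.+1) := gumbel_exp (if j == i then 1 + s else s)%R 1.
transitivity (iterint leb (fun v : k.+1.-tuple R =>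
    (\prod_(j < k.+1) f j (tnth v j))%:E)).
  congr iterint; apply/funext => v; congr EFin.
  rewrite [in LHS](bigD1 i)//= [in RHS](bigD1 i)//= mulrA; congr (_ * _)%R.
    by rewrite /f eqxx /gumbel_exp -expRD; congr expR; ring.
  by apply: eq_bigr => j /negbTE ji; rewrite /f ji.
rewrite (@iterint_prod _ _ _ leb k.+1 f); last 2 first.
- by move=> j; exact: measurable_gumbel_exp.
- by move=> j x; exact: gumbel_exp_ge0.
rewrite (bigD1_ord i)//= /f eqxx; congr (_ * _); apply: eq_bigr => j _.
by rewrite eq_sym (negbTE (neq_lift _ _)).
Qed.

(** With [s' = 1/(k-1)] and [L = ln n] the indicator says [x_i >= 1]. Integrating [v_i] outermost,
    with [exp (- exp v_i)] bounded by 1, gives [exp (s * rho) / s] for [rho = s' * (tsum t - L)].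
    Its part depending on [t] raises the remaining exponents to [s + s * s' = s']. *)
Lemma iterint_gumbel_exp_lt k (i : 'I_k.+1) (s s' L : R) : (0 < s)%R ->
  (s + s * s' = s')%R ->
  iterint leb (fun v : k.+1.-tuple R => ((tnth v i <= s' * (tsum v - tnth v i - L))%R%:R
    * \prod_(j < k.+1) gumbel_exp s 1 (tnth v j))%:E) <=
  (expR (- (s * s' * L)) / s)%:E * \prod_(j < k) gamma_log_int s'.
Proof.
move=> s0 ss'.
have mF : measurable_fun setT (fun v : k.+1.-tuple R =>
    ((tnth v i <= s' * (tsum v - tnth v i - L))%R%:R
    * \prod_(j < k.+1) gumbel_exp s 1 (tnth v j))%R%:E).
  apply/measurable_EFinP; apply: measurable_funM; last first.
    apply: (@measurable_prod_comp _ (fun=> gumbel_exp s 1)) => _.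
    exact: measurable_gumbel_exp.
  apply: measurable_ler_natr; first exact: measurable_tnth.
  apply: measurable_funM => //; apply: measurable_funB => //; apply: measurable_funB.
    exact: measurable_tsum.
  exact: measurable_tnth.
have F0 (v : k.+1.-tuple R) : 0 <= ((tnth v i <= s' * (tsum v - tnth v i - L))%R%:R
    * \prod_(j < k.+1) gumbel_exp s 1 (tnth v j))%R%:E.
  by rewrite lee_fin mulr_ge0// prodr_ge0// => j _; exact: gumbel_exp_ge0.
rewrite (iterint_insert leb i mF)// iterint_integral//; last first.
  exact: (measurableT_comp mF (measurable_insert_tuple i)).
have -> : (expR (- (s * s' * L)) / s)%:E * \prod_(j < k) gamma_log_int s' =
  iterint leb (fun t : k.-tuple R => (expR (- (s * s' * L)) / s)%:E *
    (\prod_(j < k) gumbel_exp s' 1 (tnth t j))%:E).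
  rewrite iterintZl ?iterint_gumbel_exp//.
  - apply/measurable_EFinP; apply: (@measurable_prod_comp _ (fun=> gumbel_exp s' 1)) => _.
    exact: measurable_gumbel_exp.
  - by move=> t; rewrite lee_fin prodr_ge0// => j _; exact: gumbel_exp_ge0.
  - by rewrite divr_ge0 ?expR_ge0// ltW.
apply: le_iterint.
- have := measurableT_comp mF (measurable_insert_tuple i) => mFi.
  exact: (@measurable_fun_fubini_tonelli_G _ _ _ _ _ leb _ mFi (fun=> F0 _)).
- apply: measurable_funeM; apply/measurable_EFinP.
  apply: (@measurable_prod_comp _ (fun=> gumbel_exp s' 1)) => _.
  exact: measurable_gumbel_exp.
- by move=> t; apply: integral_ge0 => x _; exact: F0.
move=> t; pose rho := (s' * (tsum t - L))%R.
pose Pi := (\prod_(j < k) gumbel_exp s 1 (tnth t j))%R.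
have Pi0 : (0 <= Pi)%R by apply: prodr_ge0 => j _; exact: gumbel_exp_ge0.
apply: (@le_trans _ _ (\int[leb]_x (Pi%:E * ((x <= rho)%R%:R * expR (s * x))%:E))).
  apply: ge0_le_integral => //.
  - have mFi := measurableT_comp mF (measurable_insert_tuple i).
    exact: (measurableT_comp mFi (measurable_pair2 t)).
  - by apply: measurable_funeM; apply/measurable_EFinP; exact: measurable_half_exp.
  - move=> x _; rewrite -EFinM lee_fin tnth_insert_id tsum_insert prod_insert.
    rewrite (_ : x + tsum t - x - L = tsum t - L)%R; last by ring.
    rewrite -/rho -/Pi mulrA mulrC ler_wpM2l// ler_wpM2l//.
    by rewrite ler_expR gerBl mul1r expR_ge0.
have mh : measurable_fun setT (fun x : R => ((x <= rho)%R%:R * expR (s * x))%:E).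
  by apply/measurable_EFinP; exact: measurable_half_exp.
have h0 (x : R) : 0 <= ((x <= rho)%R%:R * expR (s * x))%:E.
  by rewrite lee_fin mulr_ge0// expR_ge0.
rewrite ge0_integralZl//.
rewrite integral_half_exp// -!EFinM lee_fin mulrA [leRHS]mulrAC ler_wpM2r ?invr_ge0 ?(ltW s0)//.
rewrite /Pi !prod_gumbel_exp -!expRD ler_expR /rho -/(tsum t).
rewrite le_eqVlt; apply/orP; left; apply/eqP.
rewrite (_ : s' * tsum t = (s + s * s') * tsum t)%R; last by rewrite ss'.
ring.
Qed.

(** For fixed [v_i = x], each of the other [k] coordinates contributes [k * exp (x / k)], together
    [k^k * exp x]. The integral left over [x] is at most 64 by [integral_gumbel_exp_le] at
    [c = 1/4]. *)
Lemma iterint_gumbel_exp_max k (i : 'I_k.+1) : (0 < k)%N ->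
  iterint leb (fun v : k.+1.-tuple R =>
    (gumbel_exp k%:R^-1 4^-1 (tnth v i) * \prod_(j < k.+1 | j != i)
      ((tnth v j <= tnth v i)%R%:R * expR (k%:R^-1 * tnth v j)))%:E) <=
  (64 * k%:R ^+ k)%:E.
Proof.
move=> k0; set s : R := (k%:R^-1)%R; have s0 : (0 < s)%R by rewrite invr_gt0 ltr0n.
under [X in iterint leb X]eq_fun do rewrite prod_neq_lift.
set F := (X in iterint leb X).
have mF : measurable_fun setT F.
  apply/measurable_EFinP; apply: measurable_funM.
    exact: (measurableT_comp (measurable_gumbel_exp s 4^-1) (measurable_tnth i)).
  apply: measurable_prod => j _; apply: measurable_funM.
    by apply: measurable_ler_natr; exact: measurable_tnth.
  by apply: measurableT_comp => //; apply: measurable_funM => //; exact: measurable_tnth.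
have F0 v : 0 <= F v.
  rewrite lee_fin; apply: mulr_ge0; first exact: gumbel_exp_ge0.
  by apply: prodr_ge0 => j _; apply: mulr_ge0 => //; exact: expR_ge0.
rewrite (iterint_insert leb i mF)//.
have -> : (64 * k%:R ^+ k)%:E = (k%:R ^+ k)%:E * 64%:E :> \bar R.
  by rewrite -EFinM mulrC.
apply: (@le_trans _ _ (\int[leb]_x ((k%:R ^+ k)%:E * (gumbel_exp (1 + s) 4^-1 x)%:E))).
  rewrite le_eqVlt; apply/orP; left; apply/eqP; apply: eq_integral => x _.
  transitivity ((gumbel_exp s 4^-1 x)%:E * iterint leb (fun t : k.-tuple R =>
      (\prod_(j < k) ((tnth t j <= x)%R%:R * expR (s * tnth t j)))%:E)).
    rewrite -iterintZl ?gumbel_exp_ge0//; last 2 first.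
    - apply/measurable_EFinP.
      apply: (@measurable_prod_comp _ (fun _ y => ((y <= x)%R%:R * expR (s * y))%R)) => _.
      exact: measurable_half_exp.
    - by move=> t; rewrite lee_fin prodr_ge0// => j _; rewrite mulr_ge0// expR_ge0.
    congr iterint; apply/funext => t; rewrite /F -EFinM tnth_insert_id; congr (_ * _)%R%:E.
    by apply: eq_bigr => j _; rewrite tnth_insert_lift.
  rewrite (@iterint_prod _ _ _ leb k (fun _ y => ((y <= x)%R%:R * expR (s * y))%R))//;
    last by move=> _; exact: measurable_half_exp.
  under eq_bigr do rewrite integral_half_exp//.
  rewrite prodEFin -!EFinM prodr_const card_ord; congr EFin.
  rewrite exprMn /s invrK -expRM_natl mulrA [X in expR X](_ : _ = x); last first.
    by field; rewrite pnatr_eq0 -lt0n.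
  by rewrite mulrA [RHS]mulrC /gumbel_exp -expRD; congr (expR _ * _)%R; ring.
have mg : measurable_fun setT (fun x => (gumbel_exp (1 + s) 4^-1 x)%:E).
  by apply/measurable_EFinP; exact: measurable_gumbel_exp.
have g0 x : 0 <= (gumbel_exp (1 + s) 4^-1 x)%:E by rewrite lee_fin gumbel_exp_ge0.
have kk0 : 0 <= (k%:R ^+ k : R)%:E by rewrite lee_fin exprn_ge0.
rewrite ge0_integralZl//.
apply: lee_wpmul2l; first by rewrite lee_fin exprn_ge0.
have := @integral_gumbel_exp_le R s 4^-1%R.
have -> : (4 / 4^-1 ^+ 2 = 64 :> R)%R by field.
apply; last by lra.
by rewrite (ltW s0)/= invf_le1 ?ltr0n// ler1n.
Qed.

End tuple_integrals.

(** * Integrals over the unit cube in dual coordinates *)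

Section log_coordinates.
Context {R : realType}.
Local Notation leb := (@lebesgue_measure R).
Local Notation unif := (uniform_prob (@ltr01 R)).
Local Open Scope ereal_scope.

Lemma integral_uniform_log (f : R -> \bar R) :
  measurable_fun setT f -> (forall x, 0 <= f x) ->
  \int[unif]_x f x = \int[leb]_u (f (expR u) * ((u <= 0)%R%:R * expR u)%:E).
Proof.
move=> mf f0; rewrite integral_uniform// subr0 invr1 mul1e.
have mg : measurable_fun setT (fun x : R => f x * ((x <= 1)%R%:R : R)%:E).
  by apply: emeasurable_funM => //; apply/measurable_EFinP; exact: measurable_ler_l.
have g0 (x : R) : 0 <= f x * ((x <= 1)%R%:R : R)%:E by rewrite mule_ge0.
transitivity (\int[leb]_(x in `]0%R, +oo[) (f x * ((x <= 1)%R%:R : R)%:E)).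
  (* The endpoint 0, which is not an exponential, is a null set. *)
  rewrite -integral_itv_obnd_cbnd; last exact: measurable_funTS.
  rewrite [LHS]integral_mkcond [RHS]integral_mkcond.
  apply: eq_integral => x _; rewrite !patchE.
  case: ifPn => [/set_mem|/negP h]; last first.
    case: ifPn => // /set_mem /=; rewrite in_itv/= andbT => x0.
    have [x1|_] := leP x 1%R; last by rewrite mule0.
    by case: h; apply/mem_set; rewrite /= in_itv/= x0.
  rewrite /= in_itv/= => /andP[x0 ->]; rewrite ifT ?mule1//.
  by apply/mem_set; rewrite /= in_itv/= x0.
rewrite -(integral_expR_subst mg g0); apply: eq_integral => u _.
have -> : (expR u <= 1)%R = (u <= 0)%R by rewrite -[in RHS]ler_expR expR0.
by rewrite -muleA -EFinM.
Qed.

Lemma tsum_dual (L : R) k (v : k.+1.-tuple R) : (0 < k)%N ->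
  tsum (dual_tuple L v) = (k%:R^-1 * tsum v - (1 + k%:R^-1) * L)%R.
Proof.
move=> k0; have k0' : (k%:R != 0 :> R)%R by rewrite pnatr_eq0 -lt0n.
rewrite /tsum; under eq_bigr do rewrite tnth_dual.
rewrite sumrB sumr_const card_ord -/(tsum v) -[(_ *+ k.+1)%R]mulr_natr -natr1; field.
exact: k0'.
Qed.

Lemma sum_neq (I : finType) (i : I) (f : I -> R) :
  (\sum_(j | j != i) f j = \sum_j f j - f i)%R.
Proof. by rewrite [in RHS](bigD1 i)//= addrAC subrr add0r. Qed.

Lemma iterint_uniform_dual k (n : R) (F : k.+1.-tuple R -> R) : (0 < k)%N -> (0 < n)%R ->
  measurable_fun setT F -> (forall x, 0 <= F x)%R ->
  n%:E * iterint unif (fun x => (F x)%:E) =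
  (n `^ (- k%:R^-1) / k%:R)%:E * iterint leb (fun v =>
    let u := dual_tuple (ln n) v in
    (F (map_tuple expR u) * (\prod_(i < k.+1) (tnth u i <= 0)%R%:R
      * expR (k%:R^-1 * tsum v)))%:E).
Proof.
move=> k0 n0 mF F0; have k0' : (0 < k%:R :> R)%R by rewrite ltr0n.
have mFE : measurable_fun setT (fun x => (F x)%:E) by exact/measurable_EFinP.
have F0E x : 0 <= (F x)%:E by rewrite lee_fin.
have mw : measurable_fun setT (fun u : R => ((u <= 0)%R%:R * expR u)%R).
  by apply: measurable_funM => //; exact: measurable_ler_l.
have w0 (u : R) : (0 <= (u <= 0)%R%:R * expR u)%R by rewrite mulr_ge0// expR_ge0.
have := @iterint_subst _ _ _ _ _ leb unif expR _ (@measurable_expR R) mw w0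
  integral_uniform_log k.+1 _ mFE F0E.
set H := (X in iterint leb X) => ->.
have mF' := measurableT_comp mFE (measurable_map_tuple (@measurable_expR R) (k := k.+1)).
have mw' : measurable_fun setT (fun t : k.+1.-tuple R =>
    (\prod_(i < k.+1) ((tnth t i <= 0)%R%:R * expR (tnth t i))%R)%:E).
  by apply/measurable_EFinP; exact: (measurable_prod_tnth mw).
have mH : measurable_fun setT H by exact: (emeasurable_funM mF' mw').
have H0 u : 0 <= H u by rewrite mule_ge0// lee_fin prodr_ge0.
have mD := @measurable_dual_tuple R (ln n) k.
have := @iterint_dual R (ln n) k H k0 mH H0.
move=> /(congr1 (mule (k%:R^-1)%:E)); rewrite muleA -EFinM mulVf ?gt_eqF// mul1e => <-.
rewrite muleA -EFinM.
(* The factor [n * n^(1/k)] is split off because it cancels the constant [exp (- (1 + 1/k) * ln n)]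
   in the product of the [exp u_i], see [tsum_dual]. *)
have cE : (n * k%:R^-1 = (n `^ (- k%:R^-1) / k%:R) * (n * n `^ k%:R^-1))%R.
  rewrite powRN; field; rewrite gt_eqF// gt_eqF ?powR_gt0//.
rewrite cE EFinM -muleA; congr (_ * _).
rewrite -iterintZl; last 3 first.
- exact: (measurableT_comp mH mD).
- by move=> v; exact: H0.
- by rewrite mulr_ge0 ?powR_ge0// ltW.
congr iterint; apply/funext => v; rewrite /H -!EFinM; congr EFin.
rewrite mulrCA; congr (_ * _)%R; rewrite big_split/= mulrCA; congr (_ * _)%R.
rewrite -expR_sum -/(tsum (dual_tuple (ln n) v)) tsum_dual//.
rewrite -[X in (X * _ * _)%R](lnK n0) /powR gt_eqF// -!expRD; congr expR.
ring.
Qed.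

End log_coordinates.

(** * Pointwise bounds *)

Section pointwise_bounds.
Context {R : realType}.
Implicit Types (x v : R).

Lemma bernoulli_le n (a : R) : 0 <= a <= 1 -> 1 - n%:R * a <= (1 - a) ^+ n.
Proof.
move=> /andP[a0 a1]; elim: n => [|n ih]; first by rewrite mul0r subr0 expr0.
have h : 0 <= (1 - a) ^+ n by rewrite exprn_ge0// subr_ge0.
have h1 : (1 - a) ^+ n <= 1 by rewrite exprn_ile1// ?subr_ge0// gerBl.
rewrite exprSr -natr1; move: ih h h1; move: ((1 - a) ^+ n) => y; nra.
Qed.

(** Bernoulli's inequality for [1 - t^2 = (1 - t) * (1 + t)], together with [1 + t <= exp t]. *)
Lemma expRN_le_pow n (t : R) : 0 <= t <= 1 ->
  expR (- (n%:R * t)) * (1 - n%:R * t ^+ 2) <= (1 - t) ^+ n.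
Proof.
move=> /andP[t0 t1]; have t2 : 0 <= t ^+ 2 <= 1.
  by rewrite exprn_ge0//= exprn_ile1.
have := bernoulli_le n t2; have h1 := expR_ge1Dx t.
have h2 : (1 - t ^+ 2) ^+ n <= ((1 - t) * expR t) ^+ n.
  rewrite lerXn2r ?nnegrE ?subr_ge0 ?mulr_ge0 ?expR_ge0 ?subr_ge0//; first by case/andP: t2.
  by rewrite (_ : 1 - t ^+ 2 = (1 - t) * (1 + t)) ?ler_wpM2l ?subr_ge0//; ring.
move=> h3; have := le_trans h3 h2; rewrite exprMn -expRM_natl => h4.
have -> : (1 - t) ^+ n = expR (- (n%:R * t)) * ((1 - t) ^+ n * expR (n%:R * t)).
  by rewrite mulrCA -expRD addNr expR0 mulr1.
by rewrite ler_wpM2l ?expR_ge0.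
Qed.

(** For [sig >= sqrt n] the last term alone exceeds [exp (- sig)]. Otherwise [t = sig / n] satisfies
    [n * t^2 <= sig / sqrt n], and [expRN_le_pow] applies. The truncation at 0 keeps the power
    nonnegative when [sig > n]. *)
Lemma expRN_le_pow_sqrt n (sig : R) : (0 < n)%N -> 0 <= sig ->
  expR (- sig) <= Num.max 0 (1 - sig / n%:R) ^+ n.-1 +
    (Num.sqrt n%:R)^-1 * (sig * expR (- sig)).
Proof.
move=> n0 sig0; set q := Num.sqrt (n%:R : R).
have q0 : 0 < q by rewrite sqrtr_gt0 ltr0n.
have qn : q ^+ 2 = n%:R by rewrite sqr_sqrtr.
have q1 : 1 <= q by rewrite -(sqrtr1 R) ler_sqrt// ler1n.
have e0 := expR_ge0 (- sig).
have [qs|sq] := leP q sig.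
  rewrite -[leLHS]add0r lerD ?exprn_ge0 ?le_max ?lexx// mulrA ler_peMl//.
  by rewrite mulrC ler_pdivlMr// mul1r.
pose t := sig / n%:R; have nn0 : 0 < n%:R :> R by rewrite ltr0n.
have t01 : 0 <= t <= 1.
  rewrite divr_ge0//= ?(ltW nn0)// ler_pdivrMr// mul1r -qn; nra.
have nt : n%:R * t = sig by rewrite mulrCA divff ?mulr1// gt_eqF.
have := expRN_le_pow n t01; rewrite nt -/t => h.
have m1 : (1 - t) ^+ n <= Num.max 0 (1 - t) ^+ n.-1.
  have /andP[t0 t1] := t01; have ht : 0 <= 1 - t by rewrite subr_ge0.
  rewrite max_r// -[in leLHS](prednK n0) exprSr ler_piMr ?exprn_ge0// gerBl//.
have ts : n%:R * t ^+ 2 <= q^-1 * sig.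
  rewrite expr2 mulrA nt mulrC ler_wpM2r// /t -qn expr2 invfM mulrA ler_piMl ?invr_ge0 ?(ltW q0)//.
  by rewrite ler_pdivrMr// mul1r ltW.
rewrite mulrA; move: h m1 ts; nra.
Qed.

(* [nn], [Q], [p] and [eps] stand for [n], [n * dom_lower x], [n * \prod_i x_i] and
   [n^(-1/kap)]. *)
Lemma expRN_upper (nn kap eps Q p : R) : 2 <= nn -> 0 <= kap -> nn^-1 <= eps -> 0 <= Q ->
  p <= eps * (Q + Q ^+ 2) ->
  expR (- ((nn - 1) * (Q / nn))) <=
  expR (- (Q + kap * p)) + 64 * (kap + 1) * eps * expR (- (4^-1 * Q)).
Proof.
move=> n2 k0 ne Q0 pQ; have n0 : 0 < nn by lra.
have ni : 0 < nn^-1 by rewrite invr_gt0.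
have nv : nn * nn^-1 = 1 by rewrite divff// gt_eqF.
have ni2 : nn^-1 <= 2^-1 by rewrite lef_pV2 ?posrE.
(* [z] is the change of exponent to be paid for, through [exp (- a) <= exp (- a - z) + z * exp (-
   a)]. As [nn >= 2], the decay [exp (- a)] is at least as strong as [exp (- Q / 2)]. *)
pose a := (nn - 1) * (Q / nn); pose z := Q + kap * p - a.
have aE : a = Q - Q * nn^-1 by rewrite /a; ring: nv.
have a2 : 2^-1 * Q <= a by rewrite aE; nra.
have zle : z <= (kap + 1) * eps * (Q + Q ^+ 2).
  have e0 : 0 <= eps by rewrite (le_trans (ltW ni)).
  have : Q * nn^-1 <= eps * (Q + Q ^+ 2).
    by have := ler_wpM2l Q0 ne; have := mulr_ge0 e0 (sqr_ge0 Q); nra.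
  have : kap * p <= kap * (eps * (Q + Q ^+ 2)) by rewrite ler_wpM2l.
  by rewrite /z aE; lra.
have e1 : expR (- (Q + kap * p)) = expR (- a) * expR (- z).
  by rewrite -expRD /z; congr expR; ring.
have h1 := expR_ge1Dx (- z); have ea := expR_gt0 (- a).
have h2 : expR (- a) <= expR (- (Q + kap * p)) + z * expR (- a) by rewrite e1; nra.
apply: (le_trans h2); rewrite lerD2l.
have e0 : 0 <= eps by rewrite (le_trans (ltW ni)).
have Q2 : 0 <= (kap + 1) * eps * (Q + Q ^+ 2).
  by rewrite !mulr_ge0 ?addr_ge0 ?exprn_ge0.
apply: (@le_trans _ _ ((kap + 1) * eps * (Q + Q ^+ 2) * expR (- (2^-1 * Q)))).
  apply: (@le_trans _ _ ((kap + 1) * eps * (Q + Q ^+ 2) * expR (- a))).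
    by rewrite ler_wpM2r// ltW.
  by rewrite ler_wpM2l// ler_expR lerN2.
(* Half of the decay absorbs [Q + Q^2], and [exp (- Q / 4)] is left. The constant comes from
   [64 * (1 + Q/8)^2 >= Q + Q^2]. *)
rewrite (_ : - (2^-1 * Q) = - (4^-1 * Q) + - (4^-1 * Q)); last by field.
rewrite expRD mulrA ler_wpM2r ?expR_ge0//.
have e2 : expR (4^-1 * Q) = expR (8^-1 * Q) * expR (8^-1 * Q).
  by rewrite -expRD; congr expR; field.
have e3 : expR (- (4^-1 * Q)) * expR (4^-1 * Q) = 1 by rewrite -expRD addNr expR0.
have h8 := expR_ge1Dx (8^-1 * Q).
have hQ : Q + Q ^+ 2 <= 64 * expR (4^-1 * Q) by rewrite e2; nra.
have -> : 64 * (kap + 1) * eps =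
  (kap + 1) * eps * (64 * expR (4^-1 * Q)) * expR (- (4^-1 * Q)) by ring: e3.
by rewrite ler_wpM2r ?expR_ge0// ler_wpM2l// mulr_ge0// addr_ge0.
Qed.

(** The term at an index where [v] is maximal has all indicators equal to 1 and already dominates
    the left side. *)
Lemma expRN_max_sum k (v : 'I_k.+1 -> R) (c Q : R) : 0 <= c -> (forall i, expR (v i) <= Q) ->
  expR (- (c * Q)) <=
  \sum_i expR (- (c * expR (v i))) * \prod_(j | j != i) (v j <= v i)%R%:R.
Proof.
move=> c0 vQ; pose i := [arg max_(i > ord0) v i]%O.
have vi j : v j <= v i by rewrite /i; case: Order.TotalTheory.arg_maxP => // i' _; exact.
rewrite (bigD1 i)//= -[leLHS]addr0 lerD//.
  rewrite big1 => [|j _]; last by rewrite vi.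
  by rewrite mulr1 ler_expR lerN2 ler_wpM2l.
by rewrite sumr_ge0// => j _; rewrite mulr_ge0 ?expR_ge0// prodr_ge0.
Qed.

End pointwise_bounds.

(** * Bounds for the domination probability, in both coordinate systems *)

Section codominance.
Context {R : realType}.

Definition coprod k (x : k.-tuple R) (i : 'I_k) : R := \prod_(j < k | j != i) tnth x j.

(* Bounds on the probability that a uniform point [k]-dominates [x] in dimension
   [k.+1]: [dom_upper] is the union bound over the omitted coordinate, [dom_lower]
   the probability of being strictly below [x] in all coordinates but at most one. *)
Definition dom_upper k (x : k.-tuple R) : R := \sum_(i < k) coprod x i.

Definition dom_lower k (x : k.-tuple R) : R :=
  \prod_(i < k) tnth x i + \sum_(i < k) (1 - tnth x i) * coprod x i.

Lemma mul_coprod k (x : k.-tuple R) i : tnth x i * coprod x i = \prod_(j < k) tnth x j.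
Proof. by rewrite [RHS](bigD1 i). Qed.

Lemma dom_lowerE k (x : k.+1.-tuple R) :
  dom_lower x = dom_upper x - k%:R * \prod_(i < k.+1) tnth x i.
Proof.
rewrite /dom_lower /dom_upper.
under [X in _ + X]eq_bigr do rewrite mulrBl mul1r mul_coprod.
rewrite sumrB sumr_const card_ord -[(_ *+ k.+1)]mulr_natr -natr1; ring.
Qed.

(** The full product is [x_i * coprod x i], so it completes the [i]-th summand to [coprod x i]. In
    dual coordinates this bounds every [exp v_i] by [n * dom_lower x]. *)
Lemma coprod_le_dom_lower k (x : k.-tuple R) i :
  (forall j, 0 <= tnth x j <= 1) -> coprod x i <= dom_lower x.
Proof.
move=> x01; rewrite /dom_lower [X in _ + X](bigD1 i)//= -(mul_coprod x i) addrA.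
rewrite -mulrDl [tnth x i + _]addrC subrK mul1r.
rewrite lerDl sumr_ge0// => j _.
have /andP[x0 x1] := x01 j; rewrite mulr_ge0 ?subr_ge0// prodr_ge0// => l _.
by have /andP[] := x01 l.
Qed.

Lemma coprod_log k (L : R) (v : k.+1.-tuple R) i : (0 < k)%N ->
  coprod (map_tuple expR (dual_tuple L v)) i = expR (tnth v i - L).
Proof.
move=> k0; have k0' : k%:R != 0 :> R by rewrite pnatr_eq0 -lt0n.
rewrite /coprod; under eq_bigr do rewrite tnth_map.
rewrite -expR_sum sum_neq -/(tsum _) tsum_dual// tnth_dual; congr expR.
by field.
Qed.

Lemma prod_log k (L : R) (v : k.+1.-tuple R) : (0 < k)%N ->
  \prod_(i < k.+1) tnth (map_tuple expR (dual_tuple L v)) i =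
  expR (k%:R^-1 * tsum v - (1 + k%:R^-1) * L).
Proof.
move=> k0; under eq_bigr do rewrite tnth_map.
by rewrite -expR_sum -/(tsum _) tsum_dual.
Qed.

End codominance.

(** * Asymptotics of the integral *)

Section gamma_bounds.
Context {R : realType}.
Variable k : nat.
Hypothesis k2 : (2 <= k)%N.
Let s : R := k%:R^-1.
Let s' : R := (k%:R - 1)^-1.

Let kR2 : 2 <= k%:R :> R. Proof. by rewrite ler_nat. Qed.
Let kR0 : 0 < k%:R :> R. Proof. exact: lt_le_trans kR2. Qed.
Let s0 : 0 < s. Proof. by rewrite invr_gt0. Qed.
Let ks : k%:R * s = 1. Proof. by rewrite divff// gt_eqF. Qed.
Let s1 : s <= 2^-1. Proof. by rewrite lef_pV2 ?posrE. Qed.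
Let s01 : 0 < s <= 1. Proof. by rewrite s0 (le_trans s1)// invf_le1// ler1n. Qed.

(** [gamma_log_int_ge] multiplied by [1 + s]: since [k * s = 1], [k * (1 + s) - 1 = k]. *)
Lemma Gamma_inv_nat_ge : k%:R <= Gamma s * (1 + s).
Proof.
have := @gamma_log_int_ge R s s0; rewrite -gamma_log_int_Gamma// -EFinD lee_fin.
rewrite /s invrK -/s => h.
have h1 : 0 < 1 + s by rewrite addr_gt0.
have h2 : (1 + s) * (1 + s)^-1 = 1 by rewrite divff// gt_eqF.
have := ler_wpM2r (ltW h1) h; have := ks; nra.
Qed.

Lemma Gamma_inv_nat_ge_half : k%:R <= 2 * Gamma s.
Proof.
have := Gamma_inv_nat_ge; have : Gamma s >= 0.
  by rewrite -lee_fin gamma_log_int_Gamma// gamma_log_int_ge0.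
by have := s1; nra.
Qed.

(** [(1 + s)^(k+1) <= exp (s * (k + 1)) = exp (1 + s)]. This measures the error [64 * k^k] of
    [iterint_gumbel_exp_max] against the main term. *)
Lemma pow_le_Gamma : k%:R ^+ k.+1 <= expR 2 * Gamma s ^+ k.+1.
Proof.
have g0 : 0 <= Gamma s by have := Gamma_inv_nat_ge_half; have := kR2; lra.
apply: (@le_trans _ _ ((Gamma s * (1 + s)) ^+ k.+1)).
  by rewrite lerXn2r ?nnegrE ?Gamma_inv_nat_ge// ?mulr_ge0 ?addr_ge0 ?(ltW s0)// ltW.
rewrite exprMn mulrC ler_wpM2r ?exprn_ge0//.
apply: (@le_trans _ _ (expR s ^+ k.+1)).
  by rewrite lerXn2r ?nnegrE ?expR_ge0 ?addr_ge0 ?(ltW s0)// expR_ge1Dx.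
by rewrite -expRM_natl ler_expR -natr1; have := ks; have := s1; lra.
Qed.

(** As [s' = s + s s'] and the Gamma integral at [1 + s] is at most 4,
    [Gamma s' <= Gamma s + 4 s s']. With [1 <= 2 s Gamma(s)] the relative increase is at most
    [8 s * s s'], and over [k] factors it accumulates to [exp (8 s s') <= exp 4]. *)
Lemma Gamma_shift_pow_le : Gamma s' ^+ k <= expR 4 * Gamma s ^+ k.
Proof.
have kR := kR2; have k1 : 0 < k%:R - 1 :> R by lra.
have s'0 : 0 < s' by rewrite invr_gt0.
have ks' : (k%:R - 1) * s' = 1 by rewrite divff// gt_eqF.
have s'1 : s' <= 1 by rewrite invf_le1//; lra.
have kss := ks; have sh := s1; have sp := s0.
have ss' : s + s * s' = s'.
  rewrite /s /s'; field; rewrite gt_eqF//= gt_eqF//.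
have ss1 : 0 <= s * s' <= 1 by rewrite mulr_ge0 ?(ltW s'0) ?(ltW sp)//=; nra.
have g0 : 0 <= Gamma s by have := Gamma_inv_nat_ge_half; lra.
have h1 : Gamma s' <= Gamma s + s * s' * 4.
  rewrite -lee_fin gamma_log_int_Gamma ?s'0//= EFinD EFinM gamma_log_int_Gamma//.
  have := @gamma_log_int_add_le R s (s * s') ss1; rewrite ss' => /le_trans; apply.
  rewrite leeD2l// lee_wpmul2l ?lee_fin//; first by case/andP: ss1.
  have := @integral_gumbel_exp_le R s 1; rewrite expr1n divr1; apply.
    by case/andP: s01 => /ltW -> ->.
  by rewrite ltr01/= ler1n.
have h2 : Gamma s' <= Gamma s * (1 + 8 * s * (s * s')).
  apply: (le_trans h1); have := Gamma_inv_nat_ge_half => hg.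
  have : 1 <= 2 * s * Gamma s by nra.
  by case/andP: ss1 => ss0 _; move: (Gamma s) (s * s') ss0 => g a; nra.
have g'0 : 0 <= Gamma s' by rewrite -lee_fin gamma_log_int_Gamma ?s'0// gamma_log_int_ge0.
have c0 : 0 <= 8 * s * (s * s').
  by case/andP: ss1 => ss0 _; rewrite mulr_ge0// mulr_ge0// ltW.
apply: (@le_trans _ _ ((Gamma s * (1 + 8 * s * (s * s'))) ^+ k)).
  by rewrite lerXn2r ?nnegrE ?mulr_ge0 ?addr_ge0.
rewrite exprMn mulrC ler_wpM2r ?exprn_ge0//.
apply: (@le_trans _ _ (expR (8 * s * (s * s')) ^+ k)).
  by rewrite lerXn2r ?nnegrE ?expR_ge0 ?addr_ge0// expR_ge1Dx.
rewrite -expRM_natl ler_expR.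
have -> : k%:R * (8 * s * (s * s')) = 8 * (s * s') by ring: kss.
have : s * s' <= 2^-1 by nra.
by lra.
Qed.

End gamma_bounds.

(** * Two-sided bounds for the integral in dual coordinates *)

Section sandwich.
Context {R : realType}.
Variables (k n : nat) (F : k.+1.-tuple R -> R).
Hypotheses (k2 : (2 <= k)%N) (n2 : (2 <= n)%N).
Hypotheses (mF : measurable_fun setT F) (F0 : forall x, 0 <= F x).
Hypothesis F_upper : forall x : k.+1.-tuple R, (forall i, 0 <= tnth x i <= 1) ->
  F x <= expR (- ((n%:R - 1) * dom_lower x)).
Hypothesis F_lower : forall x : k.+1.-tuple R, (forall i, 0 <= tnth x i <= 1) ->
  Num.max 0 (1 - dom_upper x) ^+ n.-1 <= F x.

Local Notation leb := (@lebesgue_measure R).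
Let L : R := ln n%:R.
Let s : R := k%:R^-1.
Let s' : R := (k%:R - 1)^-1.
Let u (v : k.+1.-tuple R) := dual_tuple L v.
Let x (v : k.+1.-tuple R) : k.+1.-tuple R := map_tuple expR (u v).
Let G (v : k.+1.-tuple R) : R :=
  F (x v) * (\prod_(i < k.+1) (tnth (u v) i <= 0)%R%:R * expR (s * tsum v)).
Let sig (v : k.+1.-tuple R) : R := \sum_(i < k.+1) expR (tnth v i).
Let main (v : k.+1.-tuple R) : R := \prod_(i < k.+1) gumbel_exp s 1 (tnth v i).

Let k0 : (0 < k)%N. Proof. exact: leq_trans k2. Qed.
Let n0 : (0 < n)%N. Proof. exact: leq_trans n2. Qed.
Let nR0 : 0 < n%:R :> R. Proof. by rewrite ltr0n. Qed.
Let kR2 : 2 <= k%:R :> R. Proof. by rewrite ler_nat. Qed.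
Let s0 : 0 < s. Proof. by rewrite invr_gt0 ltr0n. Qed.
Let s1 : s <= 2^-1. Proof. by rewrite lef_pV2 ?posrE ?ltr0n. Qed.

Let eL : expR L = n%:R. Proof. by rewrite lnK. Qed.

Let x01 v : (forall i, tnth (u v) i <= 0) -> forall i, 0 <= tnth (x v) i <= 1.
Proof. by move=> u0 i; rewrite tnth_map expR_ge0/= -expR0 ler_expR. Qed.

Let coprodE v i : n%:R * coprod (x v) i = expR (tnth v i).
Proof. by rewrite coprod_log// -eL -expRD addrC subrK. Qed.

Let dom_upperE v : n%:R * dom_upper (x v) = sig v.
Proof. by rewrite mulr_sumr; apply: eq_bigr => i _; exact: coprodE. Qed.

Let mainE v : main v = expR (- sig v) * expR (s * tsum v).
Proof. by rewrite /main prod_gumbel_exp -expRD mul1r addrC. Qed.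

Let main_ge0 v : 0 <= main v.
Proof. by rewrite mainE mulr_ge0 ?expR_ge0. Qed.

(* Splitting according to the position of the largest [v_i] is sharp up to a constant,
   whereas bounding the maximum by the mean would lose a factor [k]. *)
Let maxterm (i : 'I_k.+1) (v : k.+1.-tuple R) : R :=
  gumbel_exp s 4^-1 (tnth v i) * \prod_(j < k.+1 | j != i)
    ((tnth v j <= tnth v i)%R%:R * expR (s * tnth v j)).

Let maxtermE i v : maxterm i v = expR (- (4^-1 * expR (tnth v i))) *
  (\prod_(j < k.+1 | j != i) (tnth v j <= tnth v i)%R%:R) * expR (s * tsum v).
Proof.
rewrite /maxterm big_split/= -expR_sum -mulr_sumr.
have -> : expR (s * tsum v) =
    expR (s * tnth v i) * expR (s * \sum_(j < k.+1 | j != i) tnth v j).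
  by rewrite -expRD sum_neq -/(tsum v) -mulrDr addrC subrK.
by rewrite /gumbel_exp expRD; ring.
Qed.

Let maxterm_ge0 i v : 0 <= maxterm i v.
Proof. by rewrite maxtermE !mulr_ge0 ?expR_ge0// prodr_ge0. Qed.

Let eps : R := n%:R `^ (- s).

(** [G] vanishes outside the cube. Inside, [expRN_upper] is applied with [Q + k * p = sig v], and
    its remainder is distributed over the position of the largest [v_i]. *)
Lemma sandwich_upper v :
  G v <= main v + 64 * (k%:R + 1) * eps * \sum_i maxterm i v.
Proof.
have eps0 : 0 <= eps by exact: powR_ge0.
have [/forallP u0|] := boolP [forall i, tnth (u v) i <= 0]; last first.
  rewrite negb_forall => /existsP[i /negbTE ui].
  rewrite /G (bigD1 i)//= ui !(mul0r, mulr0).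
  by rewrite addr_ge0// mulr_ge0 ?sumr_ge0// !mulr_ge0// addr_ge0.
have x1 := x01 u0; pose Q := n%:R * dom_lower (x v).
pose p := n%:R * \prod_(i < k.+1) tnth (x v) i.
have vQ i : expR (tnth v i) <= Q by rewrite -coprodE ler_wpM2l ?coprod_le_dom_lower.
have Q0 : 0 < Q by rewrite (lt_le_trans (expR_gt0 _) (vQ ord0)).
have QE : Q + k%:R * p = sig v by rewrite -dom_upperE /Q /p dom_lowerE; ring.
have epsE : eps = expR (- (s * L)) by rewrite /eps /powR gt_eqF// mulNr.
(* [p] is [eps * exp (s * tsum v)]. As each of the [k + 1] factors [exp v_i] is at most [Q], this is
   at most [eps * Q^(1+s)], and [Q^s <= 1 + Q]. *)
have pQ : p <= eps * (Q + Q ^+ 2).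
  rewrite /p prod_log// -eL -expRD epsE.
  have -> : L + (k%:R^-1 * tsum v - (1 + k%:R^-1) * L) = - (s * L) + s * tsum v.
    by rewrite /s; ring.
  rewrite expRD ler_wpM2l ?expR_ge0//.
  apply: (@le_trans _ _ (expR (s * ln Q) * Q)).
    rewrite -{2}(lnK Q0) -expRD ler_expR.
    have -> : s * ln Q + ln Q = s * (k.+1%:R * ln Q).
      by rewrite /s -natr1; field; rewrite pnatr_eq0 -lt0n.
    rewrite ler_wpM2l ?(ltW s0)//.
    have -> : k.+1%:R * ln Q = \sum_(i < k.+1) ln Q.
      by rewrite sumr_const card_ord mulr_natl.
    by apply: ler_sum => i _; rewrite -ler_expR lnK.
  have := @expR_scale_le R s (ln Q); rewrite lnK// (ltW s0)/= => h.
  have : expR (s * ln Q) <= 1 + Q by apply: h; apply: (le_trans s1); lra.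
  by nra.
have nR2 : 2 <= n%:R :> R by rewrite ler_nat.
have neps : n%:R^-1 <= eps.
  rewrite epsE -eL -expRN ler_expR lerN2.
  have L0 : 0 <= L by rewrite /L ln_ge0// ler1n.
  have s1' : s <= 1 by apply: (le_trans s1); lra.
  by rewrite -[leRHS]mul1r ler_wpM2r.
have := expRN_upper nR2 (ler0n _ k) neps (ltW Q0) pQ.
have -> : (n%:R - 1) * (Q / n%:R) = (n%:R - 1) * dom_lower (x v).
  by rewrite /Q; field; rewrite gt_eqF.
rewrite QE => hup.
have hmax := @expRN_max_sum R k (tnth v) 4^-1 Q _ vQ.
have FG := le_trans (F_upper x1) hup.
have -> : G v = F (x v) * expR (s * tsum v).
  by rewrite /G big1 ?mul1r// => i _; rewrite u0.
have -> : \sum_i maxterm i v = (\sum_i expR (- (4^-1 * expR (tnth v i))) *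
    \prod_(j < k.+1 | j != i) (tnth v j <= tnth v i)%R%:R) * expR (s * tsum v).
  by rewrite mulr_suml; apply: eq_bigr => i _; exact: maxtermE.
rewrite mainE mulrA -mulrDl ler_wpM2r ?expR_ge0//.
apply: (le_trans FG); rewrite lerD2l ler_wpM2l//; last by apply: hmax.
by rewrite !mulr_ge0// addr_ge0.
Qed.

Let q : R := Num.sqrt n%:R.

(** Outside the cube some indicator of the last sum equals 1, and that term alone is [main v].
    Inside, [expRN_le_pow_sqrt] is applied with [sig v], which is [n * dom_upper]. *)
Lemma sandwich_lower v :
  main v <= G v + q^-1 * \sum_i (expR (tnth v i) * main v) +
    \sum_i ((tnth v i <= s' * (tsum v - tnth v i - L))%R%:R * main v).
Proof.
have q0 : 0 <= q^-1 by rewrite invr_ge0 sqrtr_ge0.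
have G0 : 0 <= G v by rewrite !mulr_ge0 ?expR_ge0// prodr_ge0.
have h1 : 0 <= q^-1 * \sum_i (expR (tnth v i) * main v).
  by rewrite mulr_ge0// sumr_ge0// => i _; rewrite mulr_ge0 ?expR_ge0.
have h2 : 0 <= \sum_i ((tnth v i <= s' * (tsum v - tnth v i - L))%R%:R * main v).
  by rewrite sumr_ge0// => i _; rewrite mulr_ge0.
have [/forallP u0|] := boolP [forall i, tnth (u v) i <= 0]; last first.
  rewrite negb_forall => /existsP[i]; rewrite -ltNge tnth_dual => ui.
  rewrite -[leLHS]add0r lerD ?addr_ge0// (bigD1 i)//=.
  (* [u_i > 0] reads [k * v_i < tsum v - L]; taking one [v_i] out of the sum leaves [k - 1] on the
     left, hence [s']. *)
  suff -> : (tnth v i <= s' * (tsum v - tnth v i - L)).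
    by rewrite mul1r lerDl sumr_ge0// => j _; rewrite mulr_ge0.
  have kR := kR2; have k1 : 0 < k%:R - 1 :> R by lra.
  rewrite mulrC ler_pdivlMr//; move: ui.
  rewrite subr_gt0 ltr_pdivlMr; last by lra.
  by nra.
rewrite -[leLHS]addr0 lerD//.
have x1 := x01 u0.
have -> : G v = F (x v) * expR (s * tsum v).
  by rewrite /G big1 ?mul1r// => i _; rewrite u0.
rewrite -mulr_suml -/(sig v) mainE.
have sig0 : 0 <= sig v by rewrite sumr_ge0// => i _; exact: expR_ge0.
have := expRN_le_pow_sqrt n0 sig0; rewrite -/q => h.
have := F_lower x1.
have -> : dom_upper (x v) = sig v / n%:R.
  by rewrite -dom_upperE mulrC mulKf// gt_eqF.
move=> hF; rewrite !mulrA -mulrDl ler_wpM2r ?expR_ge0//.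
by rewrite (le_trans h)// -mulrA lerD2r.
Qed.

Let mG : measurable_fun setT G.
Proof.
apply: measurable_funM.
  apply: (measurableT_comp mF).
  apply: (measurableT_comp (measurable_map_tuple (@measurable_expR R) (k := k.+1))).
  exact: measurable_dual_tuple.
apply: measurable_funM.
  apply: measurable_prod => i _.
  exact: (measurableT_comp (measurable_ler_l 0)
    (measurableT_comp (measurable_tnth i) (@measurable_dual_tuple R L k))).
apply: measurableT_comp => //; apply: measurable_funM => //; exact: measurable_tsum.
Qed.

Let mmain : measurable_fun setT main.
Proof.
apply: (@measurable_prod_comp _ _ (fun=> gumbel_exp s 1)) => _.
exact: measurable_gumbel_exp.
Qed.

Let mmaxterm i : measurable_fun setT (maxterm i).
Proof.
rewrite /maxterm; under eq_fun do rewrite prod_neq_lift.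
apply: measurable_funM.
  exact: (measurableT_comp (measurable_gumbel_exp s 4^-1) (measurable_tnth i)).
apply: measurable_prod => j _; apply: measurable_funM.
  by apply: measurable_ler_natr; exact: measurable_tnth.
by apply: measurableT_comp => //; apply: measurable_funM => //; exact: measurable_tnth.
Qed.

Let G_ge0 v : 0 <= G v.
Proof. by rewrite !mulr_ge0 ?expR_ge0// prodr_ge0. Qed.

Let gam : R := Gamma s.

Let s01 : 0 < s <= 1.
Proof. by rewrite s0 (le_trans s1)// invf_le1// ler1n. Qed.

Let gamE : gam%:E = gamma_log_int s. Proof. exact: gamma_log_int_Gamma. Qed.

Let iterint_main : iterint leb (fun v => (main v)%:E) = (gam ^+ k.+1)%:E.
Proof.
rewrite iterint_gumbel_exp -gamE prodEFin; congr EFin.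
by rewrite prodr_const card_ord.
Qed.

Local Open Scope ereal_scope.

Lemma iterint_sandwich_upper : iterint leb (fun v => (G v)%:E) <=
  (gam ^+ k.+1 + 64 * (k%:R + 1) * eps * (k.+1%:R * (64 * k%:R ^+ k)))%:E.
Proof.
have c0 : (0 <= 64 * (k%:R + 1) * eps)%R.
  by rewrite !mulr_ge0 ?powR_ge0// addr_ge0.
have mmax i : measurable_fun setT (fun v => (maxterm i v)%:E) by exact/measurable_EFinP.
have max0 i v : 0 <= (maxterm i v)%:E by rewrite lee_fin.
have msum : measurable_fun setT (fun v => \sum_(i < k.+1) (maxterm i v)%:E).
  exact: emeasurable_sum.
have sum0 v : 0 <= \sum_(i < k.+1) (maxterm i v)%:E by exact: sume_ge0.
apply: (@le_trans _ _ (iterint leb (fun v => (main v)%:E +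
    (64 * (k%:R + 1) * eps)%:E * \sum_(i < k.+1) (maxterm i v)%:E))).
  apply: le_iterint.
  - exact/measurable_EFinP.
  - apply: emeasurable_funD; first exact/measurable_EFinP.
    exact: measurable_funeM.
  - by move=> v; rewrite lee_fin.
  - by move=> v; rewrite sumEFin -EFinM -EFinD lee_fin; exact: sandwich_upper.
rewrite iterintD; last 4 first.
- exact/measurable_EFinP.
- exact: measurable_funeM.
- by move=> v; rewrite lee_fin.
- by move=> v; rewrite mule_ge0.
rewrite iterint_main iterintZl// iterint_sum// EFinD leeD2l// [leRHS]EFinM.
apply: lee_wpmul2l; first by rewrite lee_fin.
apply: (@le_trans _ _ (\sum_(i < k.+1) (64 * k%:R ^+ k)%:E)).
  by apply: lee_sum => i _; exact: iterint_gumbel_exp_max.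
by rewrite sumEFin sumr_const card_ord [in leRHS]mulr_natl.
Qed.

Let ss' : (s + s * s' = s')%R.
Proof.
have kR := kR2; rewrite /s /s'; field.
by rewrite (gt_eqF (_ : 0 < k%:R - 1)%R) ?gt_eqF//; lra.
Qed.

Let s'01 : (0 < s' <= 1)%R.
Proof.
have kR := kR2; rewrite invr_gt0 invf_le1; first by apply/andP; split; lra.
by lra.
Qed.

(** The factor 4 bounds the Gamma integral at [1 + s], which enters through the moment term; the
    last summand integrates the region where some [x_i] exceeds 1. *)
Lemma iterint_sandwich_lower : (gam ^+ k.+1)%:E <=
  iterint leb (fun v => (G v)%:E) + (q^-1 * (k.+1%:R * (4 * gam ^+ k)))%:E +
  (k.+1%:R * (expR (- (s * s' * L)) / s * Gamma s' ^+ k))%:E.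
Proof.
have gam0 : (0 <= gam)%R by rewrite -lee_fin gamE gamma_log_int_ge0.
have q0 : (0 <= q^-1)%R by rewrite invr_ge0 sqrtr_ge0.
pose A i (v : k.+1.-tuple R) : R := (expR (tnth v i) * main v)%R.
pose B i (v : k.+1.-tuple R) : R :=
  ((tnth v i <= s' * (tsum v - tnth v i - L))%R%:R * main v)%R.
have A0 i v : 0 <= (A i v)%:E by rewrite lee_fin mulr_ge0 ?expR_ge0.
have B0 i v : 0 <= (B i v)%:E by rewrite lee_fin mulr_ge0.
have mA i : measurable_fun setT (fun v => (A i v)%:E).
  apply/measurable_EFinP; apply: measurable_funM => //.
  by apply: measurableT_comp => //; exact: measurable_tnth.
have mB i : measurable_fun setT (fun v => (B i v)%:E).
  apply/measurable_EFinP; apply: measurable_funM => //.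
  apply: measurable_ler_natr; first exact: measurable_tnth.
  apply: measurable_funM => //; apply: measurable_funB => //; apply: measurable_funB.
    exact: measurable_tsum.
  exact: measurable_tnth.
have mGE : measurable_fun setT (fun v => (G v)%:E) by exact/measurable_EFinP.
have GE0 v : 0 <= (G v)%:E by rewrite lee_fin.
have mSA : measurable_fun setT (fun v => q^-1%:E * \sum_(i < k.+1) (A i v)%:E).
  by apply: measurable_funeM; exact: emeasurable_sum.
have SA0 v : 0 <= q^-1%:E * \sum_(i < k.+1) (A i v)%:E.
  by rewrite mule_ge0 ?lee_fin// sume_ge0.
have mSB : measurable_fun setT (fun v => \sum_(i < k.+1) (B i v)%:E).
  exact: emeasurable_sum.
have SB0 v : 0 <= \sum_(i < k.+1) (B i v)%:E by exact: sume_ge0.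
have mGA : measurable_fun setT (fun v => (G v)%:E + q^-1%:E * \sum_(i < k.+1) (A i v)%:E).
  exact: emeasurable_funD.
have GA0 v : 0 <= (G v)%:E + q^-1%:E * \sum_(i < k.+1) (A i v)%:E by exact: adde_ge0.
apply: (@le_trans _ _ (iterint leb (fun v => (G v)%:E +
    q^-1%:E * \sum_(i < k.+1) (A i v)%:E + \sum_(i < k.+1) (B i v)%:E))).
  rewrite -iterint_main; apply: le_iterint.
  - exact/measurable_EFinP.
  - exact: emeasurable_funD.
  - by move=> v; rewrite lee_fin.
  - by move=> v; rewrite !sumEFin -EFinM -!EFinD lee_fin; exact: sandwich_lower.
rewrite (iterintD leb mGA mSB GA0 SB0) (iterintD leb mGE mSA GE0 SA0).
rewrite iterintZl//; last 2 first.
- exact: emeasurable_sum.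
- by move=> v; exact: sume_ge0.
rewrite (iterint_sum leb _ mA A0) (iterint_sum leb _ mB B0).
apply: leeD; first apply: leeD => //.
  rewrite [leRHS]EFinM lee_wpmul2l ?lee_fin//.
  apply: (@le_trans _ _ (\sum_(i < k.+1) (4 * gam ^+ k)%:E)).
    apply: lee_sum => i _; rewrite iterint_gumbel_exp_moment -gamE.
    rewrite prodEFin prodr_const card_ord EFinM.
    apply: lee_wpmul2r; first by rewrite lee_fin exprn_ge0.
    have := @integral_gumbel_exp_le R s 1%R; rewrite expr1n divr1; apply.
      by case/andP: s01 => /ltW -> ->.
    by rewrite ltr01/= ler1n.
  by rewrite sumEFin sumr_const card_ord [in leRHS]mulr_natl.
apply: (@le_trans _ _ (\sum_(i < k.+1) (expR (- (s * s' * L)) / s * Gamma s' ^+ k)%:E)).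
  apply: lee_sum => i _.
  apply: (le_trans (iterint_gumbel_exp_lt i L s0 ss')).
  by rewrite -(gamma_log_int_Gamma s'01) prodEFin prodr_const card_ord EFinM.
by rewrite sumEFin sumr_const card_ord [in leRHS]mulr_natl.
Qed.

Local Close Scope ereal_scope.

(** All three rates are brought to [Tn = n^(-s s')]: [n^(-s)] because [s' <= 1], and [n^(-1/2)]
    because [s s' <= 1/2]. *)
Lemma sandwich_expansion : exists e : R,
  (n%:R%:E * iterint (uniform_prob (@ltr01 R)) (fun t => (F t)%:E) =
   (n%:R `^ (- s) / k%:R * Gamma s ^+ k.+1 * (1 + e))%:E)%E /\
  `|e| <= (64 * 64 * 2 * expR 2 + 4 + 2 * expR 4) *
    (k.+1%:R * n%:R `^ (- (k%:R * (k%:R - 1))^-1)).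
Proof.
have := iterint_sandwich_upper; have := iterint_sandwich_lower.
set J := iterint leb _ => Jlo Jup.
have -> : (n%:R%:E * iterint (uniform_prob (@ltr01 R)) (fun t => (F t)%:E) =
  (n%:R `^ (- s) / k%:R)%:E * J)%E by rewrite iterint_uniform_dual.
have J0 : (0 <= J)%E by apply: iterint_ge0 => v; rewrite lee_fin.
have Jfin : J \is a fin_num by rewrite ge0_fin_numE// (le_lt_trans Jup)// ltry.
move: Jlo Jup; rewrite -(fineK Jfin) -!EFinD !lee_fin; move: (fine J) => j Jlo Jup.
pose Tn := expR (- (s * s' * L)).
have kR := kR2; have L0 : 0 <= L by rewrite ln_ge0// ler1n.
have [s'0 s'1] := andP s'01; have sp := s0; have sh := s1.
have ssp : 0 < s * s' by rewrite mulr_gt0.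
have ss2 : s * s' <= 2^-1 by have := ler_wpM2l (ltW sp) s'1; rewrite mulr1; lra.
have TnE : n%:R `^ (- (k%:R * (k%:R - 1))^-1) = Tn.
  by rewrite /powR gt_eqF// mulNr invfM.
have epsT : eps <= Tn.
  rewrite /eps /powR gt_eqF// mulNr ler_expR lerN2 ler_wpM2r//.
  by rewrite ler_piMr// ltW.
have qT : q^-1 <= Tn.
  have -> : q = expR (2^-1 * L).
    have e0 := expR_ge0 (2^-1 * L).
    rewrite /q -eL -[LHS](_ : Num.sqrt (expR (2^-1 * L) ^+ 2) = _); last first.
      by congr Num.sqrt; rewrite -expRM_natl; congr expR; field.
    by rewrite sqrtr_sqr ger0_norm.
  by rewrite -expRN ler_expR lerN2 ler_wpM2r.
have T0 : 0 < Tn by exact: expR_gt0.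
have gk := @Gamma_inv_nat_ge_half R k k2.
have g1 : 1 <= gam by move: gk; rewrite -/s -/gam; lra.
have gp := @pow_le_Gamma R k k2; have gs := @Gamma_shift_pow_le R k k2.
rewrite -/s -/s' -/gam in gk gp gs.
pose A := gam ^+ k.+1.
have A0 : 0 < A by rewrite exprn_gt0// (lt_le_trans ltr01).
have d0 : 0 < k.+1%:R :> R by rewrite ltr0n.
(* The relative error of the integral [j] with respect to the main value [A]. *)
exists (j / A - 1); split.
  by rewrite -EFinM; congr EFin; rewrite addrC subrK -/A mulrA [in RHS]mulrAC mulfK// gt_eqF.
rewrite TnE; set C := _ + _ + _.
have up : j - A <= C * (k.+1%:R * Tn) * A.
  apply: (@le_trans _ _ (64 * 64 * 2 * expR 2 * (k.+1%:R * Tn) * A)); last first.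
    rewrite ler_wpM2r ?(ltW A0)// ler_wpM2r ?mulr_ge0 ?(ltW T0)//.
    by rewrite /C -addrA lerDl addr_ge0// mulr_ge0// expR_ge0.
  rewrite lerBlDl; apply: (le_trans Jup); rewrite lerD2l.
  (* One of the two factors [k + 1] is at most [2 * k] and completes [k^k] to [k^(k+1)], absorbed by
     [exp 2 * A]; the other one stays as the factor [d] of the statement. *)
  have h1 : k.+1%:R * k%:R ^+ k <= 2 * (expR 2 * A).
    apply: (@le_trans _ _ (2 * k%:R ^+ k.+1)); last by rewrite ler_wpM2l.
    rewrite [in leRHS]exprS mulrA ler_wpM2r ?exprn_ge0// -natr1; lra.
  rewrite natr1.
  have -> : 64 * k.+1%:R * eps * (k.+1%:R * (64 * k%:R ^+ k)) =
    64 * 64 * k.+1%:R * eps * (k.+1%:R * k%:R ^+ k) by move: (64 : R) => c; ring.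
  have -> : 64 * 64 * 2 * expR 2 * (k.+1%:R * Tn) * A =
    64 * 64 * k.+1%:R * Tn * (2 * (expR 2 * A)) by move: (64 : R) => c; ring.
  apply: ler_pM => //.
  - by rewrite !mulr_ge0// powR_ge0.
  - by rewrite ler_wpM2l.
have lo : A - j <= C * (k.+1%:R * Tn) * A.
  apply: (@le_trans _ _ ((4 + 2 * expR 4) * (k.+1%:R * Tn) * A)); last first.
    rewrite ler_wpM2r ?(ltW A0)// ler_wpM2r ?mulr_ge0 ?(ltW T0)//.
    by rewrite /C -[leRHS]addrA lerDr !mulr_ge0// expR_ge0.
  have gk0 : 0 <= gam ^+ k by rewrite exprn_ge0// (le_trans ler01).
  have h1 : q^-1 * (k.+1%:R * (4 * gam ^+ k)) <= Tn * (k.+1%:R * (4 * A)).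
    apply: ler_pM => //.
    - by rewrite invr_ge0 sqrtr_ge0.
    - by rewrite !mulr_ge0.
    - by rewrite ler_wpM2l// ler_wpM2l// /A exprS ler_peMl.
  (* [1/s = k <= 2 * gam] supplies the missing power of [gam]; the shifted Gamma values cost
     [exp 4]. *)
  have h2 : k.+1%:R * (Tn / s * Gamma s' ^+ k) <= k.+1%:R * (Tn * (2 * expR 4 * A)).
    rewrite ler_wpM2l// -mulrA ler_wpM2l ?(ltW T0)// /s invrK.
    rewrite (_ : 2 * expR 4 * A = (2 * gam) * (expR 4 * gam ^+ k)); last first.
      by rewrite /A exprS; ring.
    apply: ler_pM => //; rewrite exprn_ge0//.
    by rewrite -lee_fin (gamma_log_int_Gamma s'01) gamma_log_int_ge0.
  rewrite -/A -/Tn in Jlo; lra.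
rewrite (_ : j / A - 1 = (j - A) / A); last by rewrite mulrBl divff// gt_eqF.
rewrite normrM normfV (gtr0_norm A0) ler_pdivrMr//.
by rewrite ler_norml up andbT lerNl opprB.
Qed.

End sandwich.

(** * Skyline points of a uniform sample *)

Section dominance.
Context {R : realType} (k : nat).
Hypothesis k0 : (0 < k)%N.
Local Notation dom := (@kdominates R k.+1 k).
Implicit Types x y : k.+1.-tuple R.

Lemma kdominates_of_lt (i : 'I_k.+1) y x :
  (forall j, j != i -> tnth y j < tnth x j) -> dom y x.
Proof.
move=> h; apply/existsP; exists [set~ i]%SET; apply/and3P; split.
- by rewrite cardsC1 card_ord.
- by apply/forall_inP => j; rewrite !inE => /h/ltW.
have /existsP[j ji] : [exists j : 'I_k.+1, j != i].
  apply: contraT; rewrite negb_exists => /forallP h1.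
  have := subset_leq_card (_ : [set: 'I_k.+1] \subset [set i])%SET.
  rewrite cardsT card_ord cards1 ltnNge; move: k0 => ->; apply => //.
  by apply/fintype.subsetP => j _; rewrite inE; move: (h1 j); rewrite negbK.
by apply/exists_inP; exists j; [rewrite !inE|exact: h].
Qed.

Lemma kdominates_le y x : dom y x ->
  exists i : 'I_k.+1, forall j, j != i -> tnth y j <= tnth x j.
Proof.
move=> /existsP[S /and3P[/eqP cS /forall_inP le_S _]].
have : #|~: S|%SET = 1%N.
  have := cardsC S; rewrite cS card_ord => /eqP.
  by rewrite -[X in _ == X]addn1 eqn_add2l => /eqP.
move=> /eqP/cards1P[i Si]; exists i => j ji; apply: le_S.
by move: ji; apply: contraR; rewrite -finset.in_setC Si inE.
Qed.

Lemma measurable_kdominates :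
  measurable [set p : k.+1.-tuple R * k.+1.-tuple R | dom p.1 p.2].
Proof.
have mt j : measurable_fun setT (fun p : k.+1.-tuple R * k.+1.-tuple R => tnth p.1 j).
  exact: (measurableT_comp (measurable_tnth j)).
have mt' j : measurable_fun setT (fun p : k.+1.-tuple R * k.+1.-tuple R => tnth p.2 j).
  exact: (measurableT_comp (measurable_tnth j)).
have mle j : measurable [set p : k.+1.-tuple R * k.+1.-tuple R | tnth p.1 j <= tnth p.2 j].
  have := measurable_fun_ler (mt j) (mt' j) measurableT (Y := [set true]).
  by rewrite setTI; apply.
have mlt j : measurable [set p : k.+1.-tuple R * k.+1.-tuple R | tnth p.1 j < tnth p.2 j].
  have := measurable_fun_ltr (mt j) (mt' j) measurableT (Y := [set true]).
  by rewrite setTI; apply.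
rewrite [X in measurable X](_ : _ = \bigcup_(S in [set S : {set 'I_k.+1} | #|S| == k])
  ((\bigcap_(j in [set j | j \in S]) [set p | tnth p.1 j <= tnth p.2 j]) `&`
   (\bigcup_(j in [set j | j \in S]) [set p | tnth p.1 j < tnth p.2 j]))).
  apply: fin_bigcup_measurable => [|S _]; first exact: finite_finset.
  apply: measurableI; first by apply: fin_bigcap_measurable.
  by apply: fin_bigcup_measurable.
apply/seteqP; split => p /=.
  move=> /existsP[S /and3P[cS /forall_inP le_S /exists_inP[j jS lt_j]]].
  by exists S => //=; split; [move=> l /= lS; exact: le_S|exists j].
move=> [S /= cS [le_S [j /= jS lt_j]]]; apply/existsP; exists S; rewrite cS /=.
by apply/andP; split; [apply/forall_inP => l; exact: le_S|apply/exists_inP; exists j].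
Qed.

Lemma measurable_natr_nkdominates :
  measurable_fun setT (fun p : k.+1.-tuple R * k.+1.-tuple R => (~~ dom p.1 p.2)%:R : R).
Proof.
rewrite [X in measurable_fun _ X](_ : _ =
  \1_(~` [set p : k.+1.-tuple R * k.+1.-tuple R | dom p.1 p.2])).
  by apply: measurable_indic; apply: measurableC; exact: measurable_kdominates.
apply/funext => p; rewrite indicE in_setC; congr (nat_of_bool (~~ _))%:R.
by apply/idP/idP => h; [exact/mem_set|exact: (set_mem h)].
Qed.

(** The events [y < x] in all coordinates, and [y < x] in all but the [i]-th with [x_i <= y_i], are
    pairwise disjoint and each implies domination. As an inequality of indicators this integrates
    directly. *)
Lemma nkdominates_lower_sum y x : (~~ dom y x)%:R +
  (\prod_(j < k.+1) (tnth y j < tnth x j)%R%:R + \sum_(i < k.+1)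
    (tnth x i <= tnth y i)%R%:R * \prod_(j < k.+1 | j != i) (tnth y j < tnth x j)%R%:R)
  <= 1 :> R.
Proof.
have p1 (Q : pred 'I_k.+1) : \prod_(j < k.+1 | Q j) (tnth y j < tnth x j)%R%:R = 
    [forall (j | Q j), tnth y j < tnth x j]%:R :> R.
  have [/forall_inP h|] := boolP [forall (j | Q j), tnth y j < tnth x j].
    by rewrite big1// => j /h ->.
  rewrite negb_forall => /existsP[j]; rewrite negb_imply => /andP[Qj /negbTE h].
  by rewrite (bigD1 j)//= h mul0r.
have [/existsP[i /forall_inP hi]|h] :=
    boolP [exists i, [forall (j | j != i), tnth y j < tnth x j]]; last first.
  have h' i : \prod_(j < k.+1 | j != i) (tnth y j < tnth x j)%R%:R = 0 :> R.
    by rewrite p1; move: h; rewrite negb_exists => /forallP/(_ i)/negbTE ->.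
  rewrite [X in _ + (X + _)](bigD1 ord0)//= h' mulr0 add0r big1.
    by rewrite addr0 lern1; case: dom.
  by move=> i _; rewrite h' mulr0.
rewrite (kdominates_of_lt hi) add0r (bigD1 i)//= [X in _ * X](_ : _ = 1); last first.
  by rewrite big1// => j /hi ->.
rewrite mulr1 (bigD1 i)//= [X in _ * X + _](_ : _ = 1); last first.
  by rewrite big1// => j /hi ->.
(* Only the full product and the [i]-th summand survive; they are the complementary indicators of
   [y_i < x_i] and [x_i <= y_i]. *)
rewrite mulr1 big1 ?addr0.
  by case: ltP => _; rewrite ?addr0 ?add0r.
by move=> j ji; rewrite leNgt hi// mul0r.
Qed.

(** Union bound: a set of [k] among [k + 1] coordinates omits exactly one. *)
Lemma nkdominates_upper_sum y x : 1 <= (~~ dom y x)%:R +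
  \sum_(i < k.+1) \prod_(j < k.+1 | j != i) (tnth y j <= tnth x j)%R%:R :> R.
Proof.
have s0 i : 0 <= \prod_(j < k.+1 | j != i) (tnth y j <= tnth x j)%R%:R :> R.
  exact: prodr_ge0.
have [/kdominates_le[i hi]|_] := boolP (dom y x); last by rewrite lerDl sumr_ge0.
rewrite add0r (bigD1 i)//= big1; last by move=> j /hi ->.
by rewrite lerDl sumr_ge0.
Qed.

End dominance.

(** * The uniform law on the unit interval *)

Section unit_interval_law.
Context {R : realType}.
Local Notation leb := (@lebesgue_measure R).
Local Notation unif := (uniform_prob (@ltr01 R)).
Local Open Scope ereal_scope.

Let id_unit (x : measurableTypeR R) : R := x.
Let measurable_id_unit : measurable_fun setT id_unit. Proof. exact: measurable_id. Qed.
HB.instance Definition _ := isMeasurableFun.Build _ _ _ _ id_unit measurable_id_unit.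

(* [uniform_prob] is a measure on [measurableTypeR R], whose display differs from
   the one of [R] that tuples of reals carry. *)
Definition unit_law : probability R R := distribution unif id_unit.

Lemma integral_unit_law (f : R -> \bar R) :
  measurable_fun setT f -> (forall x, 0 <= f x) ->
  \int[unit_law]_x f x = \int[unif]_x f x.
Proof. by move=> mf f0; rewrite ge0_integral_distribution. Qed.

(** A substitution along the identity with weight 1, which changes only the display. *)
Lemma iterint_unit_law k (F : k.-tuple R -> \bar R) :
  measurable_fun setT F -> (forall x, 0 <= F x) -> iterint unit_law F = iterint unif F.
Proof.
move=> mF F0.
have id1 (f : R -> \bar R) : measurable_fun setT f -> (forall x, 0 <= f x) ->
    \int[unit_law]_x f x = \int[unif]_x (f (id_unit x) * 1%:E).
  by move=> mf f0; rewrite integral_unit_law//; apply: eq_integral => x _; rewrite mule1.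
have m1 : measurable_fun setT (fun _ : measurableTypeR R => 1%R : R).
  exact: measurable_cst.
rewrite (@iterint_subst _ _ _ _ _ unif unit_law id_unit _ measurable_id_unit m1
  (fun=> ler01) id1 k F mF F0).
congr iterint; apply/funext => t; rewrite big1// mule1; congr F.
by apply: eq_from_tnth => i; rewrite tnth_map.
Qed.

Lemma unit_lawE (A : set R) : measurable A -> unit_law A = leb (A `&` `[0%R, 1%R]).
Proof.
move=> mA; have mf : measurable_fun setT (fun x : R => (\1_A x : R)%:E).
  by apply/measurable_EFinP; exact: measurable_indic.
have f0 (x : R) : 0 <= (\1_A x : R)%:E by rewrite lee_fin.
transitivity (\int[unit_law]_x (\1_A x : R)%:E); first by rewrite integral_indic// setIT.
rewrite integral_unit_law// integral_uniform// subr0 invr1 mul1e.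
by rewrite integral_indic.
Qed.

Lemma integral_unit_law_lt (a : R) : (0 <= a <= 1)%R ->
  \int[unit_law]_y ((y < a)%R%:R)%:E = a%:E.
Proof.
move=> /andP[a0 a1]; rewrite (eq_integral (fun y => (\1_(`]-oo, a[%classic) y)%:E)).
  rewrite integral_indic// setIT; apply: (etrans (unit_lawE _)) => //.
  rewrite [X in leb X](_ : _ = `[0%R, a[%classic).
    rewrite lebesgue_measure_itv/= lte_fin; case: ltP => [|h]; first by rewrite oppr0 adde0.
    by congr EFin; apply/eqP; rewrite eq_le a0 h.
  apply/seteqP; split => y /=; rewrite !in_itv/=; first by move=> [-> /andP[->]].
  by move=> /andP[-> ya]; rewrite ya (ltW (lt_le_trans ya a1)).
move=> y _; rewrite indicE; congr ((nat_of_bool _)%:R)%:E.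
by apply/idP/idP => h; [apply/mem_set; rewrite /= in_itv|
  move/set_mem: h; rewrite /= in_itv].
Qed.

Lemma integral_unit_law_le (a : R) : (0 <= a <= 1)%R ->
  \int[unit_law]_y ((y <= a)%R%:R)%:E = a%:E.
Proof.
move=> /andP[a0 a1]; rewrite (eq_integral (fun y => (\1_(`]-oo, a]%classic) y)%:E)).
  rewrite integral_indic// setIT; apply: (etrans (unit_lawE _)) => //.
  rewrite [X in leb X](_ : _ = `[0%R, a]%classic).
    rewrite lebesgue_measure_itv/= lte_fin; case: ltP => [|h]; first by rewrite oppr0 adde0.
    by congr EFin; apply/eqP; rewrite eq_le a0 h.
  apply/seteqP; split => y /=; rewrite !in_itv/=; first by move=> [-> /andP[->]].
  by move=> /andP[-> ya]; rewrite ya (le_trans ya a1).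
move=> y _; rewrite indicE; congr ((nat_of_bool _)%:R)%:E.
by apply/idP/idP => h; [apply/mem_set; rewrite /= in_itv|
  move/set_mem: h; rewrite /= in_itv].
Qed.

Lemma integral_unit_law_ge (a : R) : (0 <= a <= 1)%R ->
  \int[unit_law]_y ((a <= y)%R%:R)%:E = (1 - a)%:E.
Proof.
move=> /andP[a0 a1]; rewrite (eq_integral (fun y => (\1_(`[a, +oo[%classic) y)%:E)).
  rewrite integral_indic// setIT; apply: (etrans (unit_lawE _)) => //.
  rewrite [X in leb X](_ : _ = `[a, 1%R]%classic).
    rewrite lebesgue_measure_itv/= lte_fin; case: ltP => [//|h].
    by congr EFin; apply/esym/eqP; rewrite subr_eq0 eq_le a1 h.
  apply/seteqP; split => y /=; rewrite !in_itv/= ?andbT; first by move=> [-> /andP[_ ->]].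
  by move=> /andP[ay ->]; rewrite ay (le_trans a0 ay).
move=> y _; rewrite indicE; congr ((nat_of_bool _)%:R)%:E.
by apply/idP/idP => h; [apply/mem_set; rewrite /= in_itv/= h|
  move/set_mem: h; rewrite /= in_itv/= andbT].
Qed.

End unit_interval_law.

(** * The probability that a uniform point does not dominate a given one *)

Section nondominated_probability.
Context {R : realType} (k : nat).
Hypothesis k0 : (0 < k)%N.
Local Notation U := (@unit_law R).
Local Notation dom := (@kdominates R k.+1 k).
Local Open Scope ereal_scope.

Lemma iterint_probability1 disp (T : measurableType disp) (mu : probability T R) m :
  iterint mu (fun _ : m.-tuple T => 1) = 1.
Proof.
elim: m => //= m ih; under eq_integral do rewrite ih.
by rewrite integral_cst// mul1e; exact: probability_setT.
Qed.

(** This is [1 - beta x]. The integral is at most 1, so [fine] loses nothing. *)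
Definition nondom_prob (x : k.+1.-tuple R) : R :=
  fine (iterint U (fun y => ((~~ dom y x)%:R : R)%:E)).

Let mnd x : measurable_fun setT (fun y => ((~~ dom y x)%:R : R)%:E).
Proof.
apply/measurable_EFinP.
exact: (measurableT_comp (@measurable_natr_nkdominates R k) (measurable_pair2 x)).
Qed.

Let nd0 y x : 0 <= ((~~ dom y x)%:R : R)%:E. Proof. by rewrite lee_fin. Qed.

Let one_ge0 (t : k.+1.-tuple R) : 0 <= (1 : \bar R). Proof. by []. Qed.

Lemma nondom_probE x :
  (nondom_prob x)%:E = iterint U (fun y => ((~~ dom y x)%:R : R)%:E).
Proof.
rewrite /nondom_prob fineK// ge0_fin_numE ?iterint_ge0//.
apply: (@le_lt_trans _ _ 1); last exact: ltry.
rewrite -(iterint_probability1 U k.+1); apply: le_iterint => // y.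
by rewrite lee_fin lern1; case: dom.
Qed.

Lemma nondom_prob_ge0 x : (0 <= nondom_prob x)%R.
Proof. by rewrite -lee_fin nondom_probE iterint_ge0. Qed.

Lemma measurable_nondom_prob : measurable_fun setT nondom_prob.
Proof.
apply: (measurableT_comp (fine_measurable measurableT)).
apply: measurable_iterint => //=; apply/measurable_EFinP.
exact: (measurableT_comp (@measurable_natr_nkdominates R k)
  (@measurable_swap _ _ (k.+1.-tuple R) (k.+1.-tuple R))).
Qed.

Let mlt (a : R) : measurable_fun setT (fun y : R => ((y < a)%R%:R : R)).
Proof.
have -> : (fun y : R => ((y < a)%R%:R : R)) = (fun y => 1 - (a <= y)%R%:R)%R.
  by apply/funext => y; case: ltP; rewrite ?subr0 ?subrr.
by apply: measurable_funB => //; apply: measurable_ler_natr.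
Qed.

Lemma iterint_below_one (x : k.+1.-tuple R) (i : 'I_k.+1) :
  (forall j, 0 <= tnth x j <= 1)%R ->
  iterint U (fun y : k.+1.-tuple R =>
    (\prod_(j < k.+1 | j != i) (tnth y j <= tnth x j)%R%:R)%:E) = (coprod x i)%:E.
Proof.
move=> x01.
(* The omitted coordinate gets the constant factor 1, whose integral is the total mass, so that the
   product runs over all indices. *)
pose f (j : 'I_k.+1) (t : R) : R := if j == i then 1%R else (t <= tnth x j)%R%:R.
transitivity (iterint U (fun y : k.+1.-tuple R => (\prod_(j < k.+1) f j (tnth y j))%:E)).
  congr iterint; apply/funext => y; rewrite big_mkcond; congr EFin.
  by apply: eq_bigr => j _; rewrite /f if_neg.
rewrite (@iterint_prod _ _ _ U k.+1 f); last 2 first.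
- by move=> j; rewrite /f; case: eqP => _ //; exact: measurable_ler_l.
- by move=> j t; rewrite /f; case: eqP.
rewrite /coprod [in RHS]big_mkcond/= -prodEFin; apply: eq_bigr => j _.
rewrite /f; case: eqP => _ /=; last exact: integral_unit_law_le.
by rewrite integral_cst// mul1e; exact: probability_setT.
Qed.

Lemma nondom_prob_lower (x : k.+1.-tuple R) : (forall j, 0 <= tnth x j <= 1)%R ->
  (1 - dom_upper x <= nondom_prob x)%R.
Proof.
move=> x01; rewrite lerBlDr -lee_fin EFinD nondom_probE /dom_upper -sumEFin.
pose c i (y : k.+1.-tuple R) : R :=
  (\prod_(j < k.+1 | j != i) (tnth y j <= tnth x j)%R%:R)%R.
have c0 i y : 0 <= (c i y)%:E by rewrite lee_fin prodr_ge0.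
have mc i : measurable_fun setT (fun y => (c i y)%:E).
  apply/measurable_EFinP; rewrite /c; under eq_fun do rewrite prod_neq_lift.
  apply: measurable_prod => j _.
  exact: (measurableT_comp (measurable_ler_l _) (measurable_tnth _)).
under [X in _ + X]eq_bigr => i _ do rewrite -iterint_below_one//.
rewrite -(iterint_sum U _ mc c0) -iterintD//; last 2 first.
- exact: emeasurable_sum.
- by move=> y; exact: sume_ge0.
rewrite -(iterint_probability1 U k.+1); apply: le_iterint => //.
  by apply: emeasurable_funD => //; exact: emeasurable_sum.
by move=> y; rewrite sumEFin -EFinD lee_fin; exact: nkdominates_upper_sum.
Qed.

Lemma nondom_prob_upper (x : k.+1.-tuple R) : (forall j, 0 <= tnth x j <= 1)%R ->
  (nondom_prob x <= 1 - dom_lower x)%R.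
Proof.
move=> x01; rewrite lerBrDr -lee_fin !EFinD nondom_probE -sumEFin.
pose a (y : k.+1.-tuple R) : R := (\prod_(j < k.+1) (tnth y j < tnth x j)%R%:R)%R.
pose c i (y : k.+1.-tuple R) : R := ((tnth x i <= tnth y i)%R%:R *
  \prod_(j < k.+1 | j != i) (tnth y j < tnth x j)%R%:R)%R.
have a0 y : 0 <= (a y)%:E by rewrite lee_fin prodr_ge0.
have c0 i y : 0 <= (c i y)%:E by rewrite lee_fin mulr_ge0// prodr_ge0.
have ma : measurable_fun setT (fun y => (a y)%:E).
  apply/measurable_EFinP; apply: measurable_prod => j _.
  exact: (measurableT_comp (mlt _) (measurable_tnth _)).
have mc i : measurable_fun setT (fun y => (c i y)%:E).
  apply/measurable_EFinP; rewrite /c; under eq_fun do rewrite prod_neq_lift.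
  apply: measurable_funM.
    by apply: measurable_ler_natr => //; exact: measurable_tnth.
  apply: measurable_prod => j _.
  exact: (measurableT_comp (mlt _) (measurable_tnth _)).
have aE : iterint U (fun y => (a y)%:E) = (\prod_(i < k.+1) tnth x i)%:E.
  rewrite (@iterint_prod _ _ _ U k.+1 (fun j t => (t < tnth x j)%R%:R))//.
  by rewrite -prodEFin; apply: eq_bigr => j _; exact: integral_unit_law_lt.
have cE i : iterint U (fun y => (c i y)%:E) = ((1 - tnth x i) * coprod x i)%:E.
  pose f (j : 'I_k.+1) (t : R) : R :=
    if j == i then (tnth x i <= t)%R%:R else (t < tnth x j)%R%:R.
  transitivity (iterint U (fun y : k.+1.-tuple R => (\prod_(j < k.+1) f j (tnth y j))%:E)).
    congr iterint; apply/funext => y; rewrite [in RHS](bigD1 i)//= /f eqxx /c.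
    by congr (_ * _)%R%:E; apply: eq_bigr => j /negbTE ->.
  rewrite (@iterint_prod _ _ _ U k.+1 f); last 2 first.
  - move=> j; rewrite /f; case: eqP => _ //.
    exact: measurable_ler_natr.
  - by move=> j t; rewrite /f; case: eqP.
  rewrite (bigD1 i)//= EFinM /coprod -prodEFin; congr (_ * _).
    by rewrite /f eqxx; exact: integral_unit_law_ge.
  by apply: eq_bigr => j /negbTE ji; rewrite /f ji; exact: integral_unit_law_lt.
rewrite -aE; under [X in _ + (_ + X)]eq_bigr => i _ do rewrite -cE.
have msc : measurable_fun setT (fun y => \sum_(i < k.+1) (c i y)%:E).
  exact: emeasurable_sum.
have sc0 y : 0 <= \sum_(i < k.+1) (c i y)%:E by exact: sume_ge0.
rewrite -(iterint_sum U _ mc c0) -(iterintD U ma msc a0 sc0) -iterintD//; last 2 first.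
- exact: emeasurable_funD.
- by move=> y; exact: adde_ge0.
rewrite -(iterint_probability1 U k.+1); apply: le_iterint => //.
- by apply: emeasurable_funD => //; exact: emeasurable_funD.
- by move=> y; rewrite adde_ge0// adde_ge0.
by move=> y; rewrite sumEFin -!EFinD lee_fin; exact: nkdominates_lower_sum.
Qed.

End nondominated_probability.

(** * The expected number of skyline points as an integral over the cube *)

Section skyline_expectation.
Context {R : realType} {disp : measure_display} {T : measurableType disp}.
Variables (P : probability T R) (k m : nat).
Variable p : 'I_m.+1 -> {RV P >-> k.+1.-tuple R}.
Hypotheses (p_indep : mutually_independent p) (p_unif : forall i, uniform_cube (p i)).
Local Notation U := (@unit_law R).
Local Notation dom := (@kdominates R k.+1 k).
Local Open Scope ereal_scope.

Let Q : probability (k.+1.-tuple R) R := distribution P (p ord0).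

Let lawE i (A : 'I_k.+1 -> set R) : (forall j, measurable (A j)) ->
  distribution P (p i) [set x | forall j, A j (tnth x j)] = \prod_(j < k.+1) U (A j).
Proof.
by move=> mA; rewrite (p_unif i mA); apply: eq_bigr => j _; rewrite -unit_lawE.
Qed.

Let integral_Q (F : k.+1.-tuple R -> \bar R) : measurable_fun setT F ->
  (forall x, 0 <= F x) -> \int[Q]_x F x = iterint U F.
Proof. by move=> mF F0; apply: integral_product_law => // A mA; exact: lawE. Qed.

Let same_law i B : measurable B -> distribution P (p i) B = Q B.
Proof.
move=> mB; apply: tuple_measure_unique => // A mA.
exact: (etrans (lawE i mA) (esym (lawE ord0 mA))).
Qed.

Let X (w : T) : m.+1.-tuple (k.+1.-tuple R) := [tuple p i w | i < m.+1].

Let mX : measurable_fun setT X.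
Proof.
apply/measurable_fun_tnthP => i.
apply: (eq_measurable_fun (p i)) => [w _ /=|]; first by rewrite tnth_mktuple.
exact: measurable_funPT.
Qed.

Let integral_X (F : m.+1.-tuple (k.+1.-tuple R) -> \bar R) : measurable_fun setT F ->
  (forall t, 0 <= F t) -> \int[P]_w F (X w) = iterint Q F.
Proof.
move=> mF F0.
pose X' : {mfun T >-> m.+1.-tuple (k.+1.-tuple R)} :=
  HB.pack X (isMeasurableFun.Build _ _ _ _ _ mX).
rewrite -(integral_product_law (nu := distribution P X') _ mF F0).
  by rewrite ge0_integral_distribution.
(* Independence is used for the full index set: it gives the joint law of the sample on boxes. *)
move=> B mB; transitivity (P (\bigcap_(i in [set` [set: 'I_m.+1]%SET]) (p i @^-1` B i))).
  rewrite /distribution /pushforward/=; congr (P _); apply/seteqP; split => w /= h.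
    by move=> i _; have := h i; rewrite tnth_mktuple.
  by move=> i; rewrite tnth_mktuple; apply: h; rewrite /= inE.
rewrite p_indep//; apply: eq_big => [i|i _]; first by rewrite inE.
exact: same_law.
Qed.

Let nond (i : 'I_m.+1) (t : m.+1.-tuple (k.+1.-tuple R)) : R :=
  (\prod_(j < m.+1 | j != i) (~~ dom (tnth t j) (tnth t i))%:R)%R.

Let skyline_nond t : (#|kskyline k (tnth t)|%:R = \sum_(i < m.+1) nond i t :> R)%R.
Proof.
rewrite -sum1_card natr_sum big_mkcond; apply: eq_bigr => i _; rewrite inE.
case: ifPn => [/forallP h|].
  by rewrite /nond big1// => j ji; have := h j; rewrite ji /= => ->.
rewrite negb_forall => /existsP[j]; rewrite negb_imply => /andP[ji /negbTE h].
by rewrite /nond (bigD1 j)//= h mul0r.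
Qed.

Let mnond i : measurable_fun setT (fun t => (nond i t)%:E).
Proof.
apply/measurable_EFinP; rewrite /nond.
rewrite [Y in measurable_fun _ Y](_ : _ = fun t : m.+1.-tuple (k.+1.-tuple R) =>
  \prod_(j < m) (~~ dom (tnth t (lift i j)) (tnth t i))%:R)%R; last first.
  by apply/funext => t; rewrite prod_neq_lift.
apply: measurable_prod => j _.
apply: (measurableT_comp (@measurable_natr_nkdominates R k)
  (g := fun t : m.+1.-tuple (k.+1.-tuple R) => (tnth t (lift i j), tnth t i))).
by apply/measurable_fun_pair; exact: measurable_tnth.
Qed.

Let nond_ge0 i t : 0 <= (nond i t)%:E. Proof. by rewrite lee_fin prodr_ge0. Qed.

(** By linearity the count is a sum over sample points. Integrating the [i]-th point outermost, the
    other [m] points independently fail to dominate it, whence the power; all [m + 1] terms are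
    equal because the points have the same law. *)
Lemma expectation_skyline_count : 'E_P[skyline_count k p] =
  m.+1%:R%:E * iterint U (fun x : k.+1.-tuple R => (nondom_prob x ^+ m)%:E).
Proof.
have mN : measurable_fun setT (fun x : k.+1.-tuple R => (nondom_prob x ^+ m)%:E).
  by apply/measurable_EFinP; apply: measurable_funX; exact: measurable_nondom_prob.
have N0 (x : k.+1.-tuple R) : 0 <= (nondom_prob x ^+ m)%:E.
  by rewrite lee_fin exprn_ge0// nondom_prob_ge0.
rewrite unlock.
transitivity (\int[P]_w \sum_(i < m.+1) (nond i (X w))%:E).
  apply: eq_integral => w _; rewrite sumEFin -skyline_nond /skyline_count.
  congr (#|kskyline k _|%:R)%:E; apply/funext => i; by rewrite tnth_mktuple.
rewrite (integral_X (F := fun t => \sum_(i < m.+1) (nond i t)%:E)); last 2 first.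
- exact: emeasurable_sum.
- by move=> t; exact: sume_ge0.
rewrite (iterint_sum Q _ mnond nond_ge0).
rewrite (eq_bigr (fun=> iterint U (fun x : k.+1.-tuple R => (nondom_prob x ^+ m)%:E))); last first.
  move=> i _; rewrite (iterint_insert Q i (mnond i))// -integral_Q//.
  apply: eq_integral => x _.
  transitivity (iterint Q (fun t : m.-tuple (k.+1.-tuple R) =>
      (\prod_(j < m) ((~~ dom (tnth t j) x)%:R : R))%:E)).
    congr iterint; apply/funext => t; congr EFin; rewrite /nond prod_neq_lift.
    by apply: eq_bigr => j _; rewrite tnth_insert_id tnth_insert_lift.
  have md : measurable_fun setT (fun y => (~~ dom y x)%:R : R).
    exact: (measurableT_comp (@measurable_natr_nkdominates R k) (measurable_pair2 x)).
  rewrite (@iterint_prod _ _ _ Q m (fun _ y => (~~ dom y x)%:R))//.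
  have dE : \int[Q]_y ((~~ dom y x)%:R : R)%:E = (nondom_prob x)%:E.
    by rewrite integral_Q ?nondom_probE//; exact/measurable_EFinP.
  rewrite dE.
  by rewrite prodEFin prodr_const card_ord.
set c := iterint U _; rewrite (eq_bigr (fun=> 1%:E * c)); last by move=> i _; rewrite mul1e.
by rewrite -ge0_sume_distrl// sumEFin sumr_const card_ord.
Qed.

End skyline_expectation.

Theorem theorem6 (R : realType) :
  exists C : R, forall d : nat -> nat,
    (forall n, (3 <= d n)%N) ->
    (fun n : nat => 2 * ln (n%:R : R) / (d n)%:R ^+ 2
                    - lambertW (2 * ln (n%:R : R))) @ \oo --> +oo ->
  exists N : nat, forall n : nat, (N <= n)%N ->
  forall (disp : measure_display) (T : measurableType disp)
    (P : probability T R) (p : 'I_n -> {RV P >-> (d n).-tuple R}),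
    mutually_independent p ->
    (forall i, uniform_cube (p i)) ->
  let D : R := (d n)%:R in
  exists e : R,
    ('E_P[skyline_count (d n).-1 p])%E =
      (n%:R `^ (- (D - 1)^-1) / (D - 1) * Gamma ((D - 1)^-1) ^+ d n * (1 + e))%:E
    /\ `|e| <= C * (D * n%:R `^ (- ((D - 1) * (D - 2))^-1)).

Proof.
(* The constant is that of [sandwich_expansion]: its parts come from the upper exponential
   approximation, the lower one, and the removal of [x_i <= 1]. The threshold 2 ensures
   [n - 1 >= n / 2]. *)
exists (64 * 64 * 2 * expR 2 + 4 + 2 * expR 4) => d d3 _; exists 2%N => n n2.
move=> disp T P p p_indep p_unif D.
(* From here [n = m + 1] and [d = k + 1] with [k >= 2], so that [D - 1] is [k] and [D - 2] is
   [k - 1]. *)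
move: n n2 p p_indep p_unif @D; case=> // m m2; case: (d _) (d3 m.+1) => // k; rewrite ltnS => k2.
move=> p p_indep p_unif /=.
have -> : k.+1%:R - 1 = k%:R :> R by rewrite -natr1 addrK.
have -> : k.+1%:R - 2 = k%:R - 1 :> R by rewrite -natr1; ring.
have k0 : (0 < k)%N by rewrite (leq_trans _ k2).
pose F (x : k.+1.-tuple R) := nondom_prob x ^+ m.
have F0 x : 0 <= F x by rewrite exprn_ge0// nondom_prob_ge0.
have mF : measurable_fun setT F.
  by apply: measurable_funX; exact: measurable_nondom_prob.
have F_upper (x : k.+1.-tuple R) : (forall i, 0 <= tnth x i <= 1) ->
    F x <= expR (- ((m.+1%:R - 1) * dom_lower x)).
  move=> x01; rewrite -natr1 addrK -mulrN expRM_natl lerXn2r ?nnegrE ?expR_ge0 ?nondom_prob_ge0//.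
  exact: (le_trans (nondom_prob_upper k0 x01) (expR_ge1Dx _)).
have F_lower (x : k.+1.-tuple R) : (forall i, 0 <= tnth x i <= 1) ->
    Num.max 0 (1 - dom_upper x) ^+ m.+1.-1 <= F x.
  (* [1 - dom_upper x] may be negative; the maximum with 0 makes raising to the power monotone. *)
  move=> x01; rewrite lerXn2r ?nnegrE ?nondom_prob_ge0 ?le_max ?lexx//.
  by rewrite ge_max nondom_prob_ge0 nondom_prob_lower.
have [e [eE e_le]] := sandwich_expansion k2 m2 mF F0 F_upper F_lower.
exists e; split.
  rewrite expectation_skyline_count// iterint_unit_law.
  - by rewrite -[RHS]eE.
  - exact/measurable_EFinP.
  - by move=> x; rewrite lee_fin; exact: F0.
exact: e_le.
Qed.
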